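(* Let $P,Q\in\mathbb{R}[x,y]$, both not identically zero, and suppose that the system $\dot x=P(x,y)$, $\dot y=Q(x,y)$ is a semi-quasi homogeneous but non-semihomogeneous polynomial differential system of degree $n=\max\{\deg P,\deg Q\}$. (i) If $n=2$, then the system has no center. (ii) If $n=3$, then the system has a center if and only if, after a linear transformation of coordinates and a rescaling of time, it can be written as $$\dot x=-y^3+x^2,\qquad \dot y=x. \qquad ( * )$$ Moreover, system $( * )$ has the first integral $$H(x,y)=\Bigl(y^3+\tfrac32 y^2+\tfrac32 y-x^2+\tfrac34\Bigr)e^{-2y},$$ with integrating factor $M(y)=-2e^{-2y}$, and the period annulus of the center of $( * )$ corresponds to the level curves $H(x,y)=h$ with $h\in(0,3/4)$.
   Context: The system $\dot x=P(x,y)$, $\dot y=Q(x,y)$ is semi-quasi homogeneous if there exist positive integers $s_1,s_2,d_1,d_2$ with $d_1\neq d_2$ such that for all real $\alpha>0$, $$P(\alpha^{s_1}x,\alpha^{s_2}y)=\alpha^{s_1-1+d_1}P(x,y),\qquad Q(\alpha^{s_1}x,\alpha^{s_2}y)=\alpha^{s_2-1+d_2}Q(x,y).$$ The system is called semihomogeneous if $P$ and $Q$ are both homogeneous polynomials (of possibly equal or different degrees); non-semihomogeneous means that this is not the case. A center is a singular point having a punctured neighbourhood filled with periodic orbits; its period annulus is the maximal punctured neighbourhood of the center filled with periodic orbits surrounding it. A linear transformation is an invertible linear change of the variables $(x,y)$, and a rescaling of time is $T=\gamma t$ with a nonzero real constant $\gamma$. Integrating factor means that $M P=-\partial H/\partial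 y$ and $M Q=\partial H/\partial x$. *)

(* Defs.v *)
From HB Require Import structures.
From mathcomp Require Import all_boot all_order all_algebra.
From mathcomp Require Import all_classical all_reals all_analysis.
(* The notations of mpoly conflict with those of analysis. *)
From mathcomp Require Import -(notations) mpoly.

Set Implicit Arguments.
Unset Strict Implicit.
Unset Printing Implicit Defensive.

Import Order.TTheory GRing.Theory Num.Theory.
Import numFieldNormedType.Exports.

Local Open Scope classical_set_scope.
Local Open Scope ring_scope.

Notation bipoly R := (mpoly 2 R).

Section Polynomials.
Context {R : realType}.
Implicit Types P Q : bipoly R.

Definition eval2 P (x y : R) : R :=
  meval (fun i : 'I_2 => [:: x; y]`_i) P.

(* [msize] is one more than the total degree. *)
Definition total_degree P : nat := (msize P).-1.

Definition polysys P Q (z : R * R) : R * R := (eval2 P z.1 z.2, eval2 Q z.1 z.2).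

(* All the weights are positive, so the truncated subtractions are exact. *)
Definition semi_quasi_homogeneous P Q : Prop :=
  exists s1 s2 d1 d2 : nat,
    [/\ [/\ (0 < s1)%N, (0 < s2)%N, (0 < d1)%N & (0 < d2)%N], d1 <> d2 &
    forall a x y : R, 0 < a ->
      eval2 P (a ^+ s1 * x) (a ^+ s2 * y) = a ^+ (s1 - 1 + d1) * eval2 P x y /\
      eval2 Q (a ^+ s1 * x) (a ^+ s2 * y) = a ^+ (s2 - 1 + d2) * eval2 Q x y].

Definition semihomogeneous P Q : Prop :=
  P \is ishomog mdeg /\ Q \is ishomog mdeg.

End Polynomials.

Section PlanarSystems.
Context {R : realType}.
Implicit Types (F G : R * R -> R * R) (z : R * R) (A O : set (R * R)).

(* At an endpoint belonging to I, the derivative is the two-sided one. *)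
Definition solution_on (I : set R) F (g : R -> R * R) : Prop :=
  forall t, I t ->
    is_derive t 1 (fun s => (g s).1) (F (g t)).1 /\
    is_derive t 1 (fun s => (g s).2) (F (g t)).2.

Definition periodic_orbit F O : Prop :=
  exists (g : R -> R * R) (T : R),
    [/\ solution_on setT F g, 0 < T, forall t, g (t + T) = g t,
        exists t, g t <> g 0 & O = range g].

Definition singular_point F z : Prop := F z = (0, 0).

Definition punctured_nbhd z A : Prop :=
  exists U, [/\ open U, connected U, U z & A = U `\ z].

Definition is_center F z : Prop :=
  singular_point F z /\
  exists2 A, punctured_nbhd z A &
    forall w, A w -> exists O, [/\ periodic_orbit F O, O w & O `<=` A].

(* z lies in the bounded component of the complement of the Jordan curve O. *)
Definition surrounds O z : Prop :=
  ~ O z /\ bounded_set (connected_component (~` O) z).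

Definition filled_around F z A : Prop :=
  punctured_nbhd z A /\
  forall w, A w ->
    exists O, [/\ periodic_orbit F O, O w, O `<=` A & surrounds O z].

(* The candidates are stable under unions, so the maximal one is the greatest. *)
Definition period_annulus F z A : Prop :=
  filled_around F z A /\ forall B, filled_around F z B -> B `<=` A.

Definition linear_act (L : 'M[R]_2) z : R * R :=
  (L 0 0 * z.1 + L 0 1 * z.2, L 1 0 * z.1 + L 1 1 * z.2).

(* In the variables w = L z and T = c t, the system dz/dt = F z reads
   dw/dT = c^-1 L (F z), and this has to be G w. *)
Definition can_be_written_as F G : Prop :=
  exists (L : 'M[R]_2) (c : R), [/\ L \in unitmx, c != 0 &
    forall z, linear_act L (F z) =
      (c * (G (linear_act L z)).1, c * (G (linear_act L z)).2)].

Definition first_integral F (H : R * R -> R) : Prop :=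
  [/\ forall z, differentiable H z,
      forall U : set (R * R), open U -> U !=set0 ->
        exists z w, [/\ U z, U w & H z <> H w] &
      forall (a b : R) (g : R -> R * R), solution_on `]a, b[ F g ->
        forall s t, s \in `]a, b[ -> t \in `]a, b[ -> H (g s) = H (g t)].

Definition integrating_factor F (H M : R * R -> R) : Prop :=
  forall x y : R,
    is_derive y 1 (fun v => H (x, v)) (- (M (x, y) * (F (x, y)).1)) /\
    is_derive x 1 (fun u => H (u, y)) (M (x, y) * (F (x, y)).2).

Definition star (z : R * R) : R * R := (- z.2 ^+ 3 + z.1 ^+ 2, z.1).

Definition starH (z : R * R) : R :=
  (z.2 ^+ 3 + 3 / 2 * z.2 ^+ 2 + 3 / 2 * z.2 - z.1 ^+ 2 + 3 / 4)
  * expR (- 2 * z.2).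

Definition starM (z : R * R) : R := - 2 * expR (- 2 * z.2).

Definition level_curve (H : R * R -> R) (h : R) : set (R * R) := [set z | H z = h].

End PlanarSystems.

(* Main.v *)
Require Import Defs.
From HB Require Import structures.
From mathcomp Require Import all_boot all_order all_algebra.
From mathcomp Require Import all_classical all_reals all_analysis.
From mathcomp Require Import -(notations) mpoly.
From mathcomp Require Import ring lra zify.

Set Implicit Arguments.
Unset Strict Implicit.
Unset Printing Implicit Defensive.

Import Order.TTheory GRing.Theory Num.Theory.
Import numFieldNormedType.Exports.

Local Open Scope classical_set_scope.
Local Open Scope ring_scope.

(** The weights [s1], [s2] of a non-semihomogeneous system differ; by exchanging
the coordinates, take [s1 < s2].  A center can only be the origin, because a
singular point off the origin lies on a curve of singular points.  The flow
crosses each coordinate axis, and it cannot do so in one direction only: hence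
[P] contains [a y^k] and [Q] contains [d x^l] with [k] and [l] odd and
[a d < 0].  In degree at most three only five families survive, with weights
proportional to (1,2), (1,3) or (2,3).  In four of them some orbits near the
origin are not periodic, because of a monotone function or of a region, thin
around a branch of a nullcline, in which [x] is monotone forever.  The fifth
family is a linear rescaling of [( * )].

For [( * )] put [X = x e^(-y)] and let [phi y = H (0, y)], so that
[H = phi - X^2] and [3/4 - phi = S^4] for an increasing function [S].  The level
curves are then the ovals [X^2 + S^4 = 3/4 - h], parametrized by
[S = l sin t], [X = l^2 cos t sqrt (1 + sin^2 t)] with [l^4 = 3/4 - h];
reparametrizing this closed curve by time, a quadrature, turns it into a
periodic solution.  On the levels [h <= 0] the coordinate [x] is increasing. *)

(** * Derivatives, invariant regions and Gronwall's lemma *)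

(** The non-existence part lives on what the definition of a center supplies: through every point
    near it passes a non-constant periodic solution, defined for all times. A periodic function
    takes each of its values at a nonnegative time, so a region that traps solutions forward traps
    periodic ones for ever, and a coordinate whose derivative never vanishes there contradicts
    Rolle's theorem. For the existence part, periodic solutions are exhibited explicitly. Uniqueness
    of solutions, by Gronwall's lemma, serves twice: for singular points off the origin, and to show
    that an orbit in the annulus fills a whole level curve.

    The condition [d1 <> d2] removes systems such as x' = a y, y' = c x y + d x^3, which carry the
    weights (1,2) and may have a center.

    The fourth power in the treatment of the star system comes from phi' = - 2 y^3 e^(-2y): the
    function 3/4 - phi vanishes to order exactly four at 0. Its signed fourth root therefore has a
    nonzero derivative even at 0, hence a differentiable inverse, and the ovals get a
    parametrization without singular points. *)

Section Derivatives.
Context {R : realType}.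
Implicit Types (f g : R -> R) (a b t : R).

Lemma isd_eq t f a b : is_derive t 1 f a -> a = b -> is_derive t 1 f b.
Proof. by move=> ? <-. Qed.

Lemma isd_id t : is_derive t 1 (fun s : R => s) 1.
Proof. exact: is_derive_id. Qed.

Lemma isd_cst t a : is_derive t 1 (fun _ : R => a) 0.
Proof. exact: is_derive_cst. Qed.

Lemma isdD t f g a b : is_derive t 1 f a -> is_derive t 1 g b ->
  is_derive t 1 (fun s => f s + g s) (a + b).
Proof. exact: is_deriveD. Qed.

Lemma isdN t f a : is_derive t 1 f a -> is_derive t 1 (fun s => - f s) (- a).
Proof. exact: is_deriveN. Qed.

Lemma isdM t f g a b : is_derive t 1 f a -> is_derive t 1 g b ->
  is_derive t 1 (fun s => f s * g s) (a * g t + f t * b).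
Proof.
move=> fa gb; have := @is_deriveM R R^o f g t 1 a b fa gb.
by move/isd_eq; apply; rewrite addrC /GRing.scale /= [g t * _]mulrC.
Qed.

Lemma isdX n t f a : is_derive t 1 f a ->
  is_derive t 1 (fun s => f s ^+ n) (n%:R * f t ^+ n.-1 * a).
Proof.
move=> fa; elim: n => [|n IHn].
  by apply: isd_eq (isd_cst t 1) _; rewrite !mul0r.
under eq_fun do rewrite exprS; apply: isd_eq (isdM fa IHn) _.
case: n {IHn} => [|n] /=; first by rewrite !mul0r mulr0 expr0; ring.
by rewrite !exprS -[n.+2]addn1 -[n.+1]addn1 !natrD; ring.
Qed.

Lemma isd_comp t f g a b : is_derive t 1 g a -> is_derive (g t) 1 f b ->
  is_derive t 1 (fun s => f (g s)) (b * a).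
Proof. by move=> ga fb; apply: is_derive1_comp. Qed.

Lemma isd_expR t f a : is_derive t 1 f a ->
  is_derive t 1 (fun s => expR (f s)) (expR (f t) * a).
Proof. by move=> fa; apply: isd_comp. Qed.

End Derivatives.

(** Differentiation by the shape of the expression. The leaves that are neither constants nor the
    variable go to [tac]; [der] leaves the equality between the computed derivative and the expected
    one. *)
Ltac der_with tac :=
  lazymatch goal with
  | |- is_derive ?t _ (fun _ => ?c) _ => notypeclasses refine (isd_cst t c)
  | |- is_derive ?t _ (fun s => s) _ => notypeclasses refine (isd_id t)
  | |- is_derive ?t _ (fun s => @?f s + @?g s) _ =>
    notypeclasses refine (@isdD _ t f g _ _ _ _); der_with tac
  | |- is_derive ?t _ (fun s => @?f s * @?g s) _ =>
    notypeclasses refine (@isdM _ t f g _ _ _ _); der_with tac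
  | |- is_derive ?t _ (fun s => - @?f s) _ =>
    notypeclasses refine (@isdN _ t f _ _); der_with tac
  | |- is_derive ?t _ (fun s => @?f s ^+ ?n) _ =>
    notypeclasses refine (@isdX _ n t f _ _); der_with tac
  | |- is_derive ?t _ (fun s => expR (@?f s)) _ =>
    notypeclasses refine (@isd_expR _ t f _ _); der_with tac
  | |- _ => tac
  end.
Tactic Notation "der" tactic3(tac) :=
  notypeclasses refine (isd_eq _ _); [der_with tac|rewrite ?/id /=].

Section MeanValue.
Context {R : realType}.
Implicit Types (f g : R -> R) (a b t : R).

Lemma isd_cont t f a : is_derive t 1 f a -> {for t, continuous f}.
Proof.
by case=> + _ => /derivable1_diffP/differentiable_continuous.
Qed.

Lemma mvt f df a b : a < b ->
  (forall t, a <= t <= b -> is_derive t 1 f (df t)) ->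
  exists2 c, a < c < b & f b - f a = df c * (b - a).
Proof.
move=> ab fd; have [||c] := @MVT _ f df a b ab.
- by move=> x; rewrite in_itv /= => /andP[ax xb]; apply: fd; rewrite !ltW.
- apply: derivable_within_continuous => x; rewrite in_itv /= => xab.
  by have [] := fd _ xab.
- by rewrite in_itv /= => cab ->; exists c.
Qed.

(** The product with [h] treats both sides of [t] at once: it is [h ^+ 2] times the difference
    quotient. *)
Lemma isd_gt0_near t f a : is_derive t 1 f a -> 0 < a ->
  exists2 d, 0 < d & forall h, h != 0 -> `|h| < d -> 0 < h * (f (t + h) - f t).
Proof.
move=> [fd fa] a0.
have : (fun h : R => h^-1 *: ((f \o shift t) (h *: (1 : R)) - f t)) @ 0^' --> a.
  by rewrite -fa.
move=> /cvgr_gt /(_ 0 a0) /nbhs_ballP[d /= d0 dP]; exists d => // h h0 hd.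
have /dP/(_ h0) : ball 0 d h by rewrite /ball /= sub0r normrN.
rewrite /= /GRing.scale /= mulr1 [h + t]addrC => {}dP.
rewrite (_ : h * _ = h ^+ 2 * (h^-1 * (f (t + h) - f t))).
  by rewrite mulr_gt0// exprn_even_gt0.
by rewrite expr2 mulrA mulfK.
Qed.

Lemma isd_min0 t f a : is_derive t 1 f a -> (forall s, f t <= f s) -> a = 0.
Proof.
move=> fa fmin; apply/eqP; case: (ltgtP a 0) => // a0.
- have /isdN fa' := fa; have [|d d0 dP] := isd_gt0_near fa'; first by rewrite oppr_gt0.
  have := dP (d / 2); rewrite gt_eqF ?divr_gt0// gtr0_norm ?divr_gt0//.
  have := fmin (t + d / 2) => ? /(_ isT) H.
  have : 0 < d / 2 * (- f (t + d / 2) - - f t) by apply: H; lra.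
  by rewrite pmulr_rgt0 ?divr_gt0//; lra.
- have [d d0 dP] := isd_gt0_near fa a0.
  have := dP (- (d / 2)); rewrite oppr_eq0 gt_eqF ?divr_gt0// normrN gtr0_norm ?divr_gt0//.
  have := fmin (t - d / 2) => ? /(_ isT) H.
  have : 0 < - (d / 2) * (f (t - d / 2) - f t) by apply: H; lra.
  by rewrite nmulr_rgt0 ?oppr_lt0 ?divr_gt0//; lra.
Qed.

Lemma isd_ge0_homo f df : (forall t, is_derive t 1 f (df t)) ->
  (forall t, 0 <= df t) -> {homo f : s t / s <= t}.
Proof.
move=> fd df0 s t; rewrite le_eqVlt => /predU1P[->//|st].
have [c _] := mvt st (fun t _ => fd t).
by rewrite -subr_ge0 => ->; rewrite mulr_ge0// subr_ge0 ltW.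
Qed.

(** A positive derivative at [t] gives [f (t + h) > f t] for some [h <= T], whereas monotonicity and
    periodicity give [f (t + h) <= f (t + T) = f t]. *)
Lemma periodic_isd_eq0 f df T : 0 < T -> (forall t, f (t + T) = f t) ->
  (forall t, is_derive t 1 f (df t)) -> (forall t, 0 <= df t) ->
  forall t, df t = 0.
Proof.
move=> T0 fT fd df0 t; have fh := isd_ge0_homo fd df0.
apply/eqP; rewrite eq_le df0 andbT leNgt; apply/negP => dft.
have [d d0 dP] := isd_gt0_near (fd t) dft.
pose h := Order.min (d / 2) T.
have h0 : 0 < h by rewrite lt_min T0 divr_gt0.
have hT : h <= T by rewrite ge_min lexx orbT.
have hd : h < d by rewrite gt_min; apply/orP; left; lra.
have := dP h; rewrite gt_eqF// gtr0_norm// => /(_ isT hd).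
rewrite pmulr_rgt0// subr_gt0; apply/negP; rewrite -leNgt -[leRHS]fT.
by apply: fh; lra.
Qed.

(** Forward invariance of a region cut out by finitely many inequalities. The derivative has to be
    positive on a face only where the other inequalities hold too. The proof looks at the infimum
    [m] of the exit times. *)
Lemma trap (I : finType) (u du : I -> R -> R) :
  (forall i (t : R), is_derive t 1 (u i) (du i t)) ->
  (forall i, 0 <= u i 0) ->
  (forall i t, 0 <= t -> (forall j, 0 <= u j t) -> u i t = 0 -> 0 < du i t) ->
  forall i t, 0 <= t -> 0 <= u i t.
Proof.
move=> ud u0 uP i t t0; rewrite leNgt; apply/negP => uit.
pose S := [set s : R | 0 <= s /\ exists j, u j s < 0].
have S0 : S !=set0 by exists t; split => //; exists i.
have Slb : lbound S 0 by move=> s [].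
have Si : has_inf S by split => //; exists 0.
pose m := inf S; have m0 : 0 <= m by apply: lb_le_inf.
(* No inequality fails at time [m]: by continuity it would fail slightly earlier as well, and it
   holds at time 0. *)
have um j : 0 <= u j m.
  rewrite leNgt; apply/negP => ujm.
  have m1 : 0 < m.
    by rewrite lt_def m0 andbT; apply/eqP => m00; move: ujm; rewrite m00 ltNge u0.
  have /cvgrPdist_lt/(_ (- u j m)) := isd_cont (ud j m).
  rewrite oppr_gt0 => /(_ ujm)/nbhs_ballP[d /= d0 dP].
  pose h := Order.min (d / 2) m.
  have h0 : 0 < h by rewrite lt_min m1 divr_gt0.
  have hm : h <= m by rewrite ge_min lexx orbT.
  have hd : h < d by rewrite gt_min; apply/orP; left; lra.
  have /dP : ball m d (m - h).
    by rewrite /ball /= opprB addrCA subrr addr0 gtr0_norm.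
  rewrite ltr_norml => /andP[H _].
  have : S (m - h) by split; [lra|exists j; lra].
  by move=> /(ge_inf Si.2); rewrite -/m; lra.
(* Each inequality persists a little after [m], by continuity if strict, by the sign of the
   derivative if it is an equality. *)
have near_pos j : exists2 d, 0 < d & forall h, 0 <= h -> h < d -> 0 <= u j (m + h).
  have [uj0|ujn0] := eqVneq (u j m) 0.
    have [d d0 dP] := isd_gt0_near (ud j m) (uP _ _ m0 um uj0).
    exists d => // h; rewrite le_eqVlt => /predU1P[<- _|h0 hd].
      by rewrite addr0.
    have := dP h; rewrite gt_eqF// gtr0_norm// => /(_ isT hd).
    by rewrite pmulr_rgt0// uj0 subr0 => /ltW.
  have ujp : 0 < u j m by rewrite lt_def ujn0 um.
  have /cvgrPdist_lt/(_ _ ujp)/nbhs_ballP[d /= d0 dP] := isd_cont (ud j m).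
  exists d => // h h0 hd.
  have /dP : ball m d (m + h).
    by rewrite /ball /= opprD addrA subrr sub0r normrN ger0_norm.
  by rewrite ltr_norml => /andP[_ H]; lra.
(* Finiteness of [I] gives one delay for all inequalities, so that no exit occurs before [m + D]. *)
have [D D0 DP] : exists2 d, 0 < d & forall j h, 0 <= h -> h < d -> 0 <= u j (m + h).
  pose d j := s2val (cid2 (near_pos j)).
  exists (\big[Order.min/1]_j d j).
    by apply: lt_bigmin => // j _; rewrite /d; case: cid2.
  move=> j h h0 hd; have := s2valP' (cid2 (near_pos j)); apply => //.
  by apply: lt_le_trans hd _; exact: bigmin_le.
have : m + D <= m.
  apply: lb_le_inf => // s Ss; have ms : m <= s by apply: (ge_inf Si.2).
  rewrite leNgt; apply/negP => sD; case: Ss => _ [j]; apply/negP.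
  have E : m + (s - m) = s by ring.
  by have := DP j (s - m); rewrite E -leNgt; apply; lra.
by lra.
Qed.

(** The functions [v t * expR (- K * t)] and [v t * expR (K * t)] are monotone in opposite
    directions. A zero at either end is allowed, because the initial time 0 may be the left or the
    right end of the interval. *)
Lemma gronwall0 (v dv : R -> R) (a b K : R) : a <= b ->
  (forall t, a <= t <= b -> is_derive t 1 v (dv t)) ->
  (forall t, a <= t <= b -> 0 <= v t) ->
  (forall t, a <= t <= b -> `|dv t| <= K * v t) ->
  v a = 0 \/ v b = 0 -> forall t, a <= t <= b -> v t = 0.
Proof.
move=> ab vd v0 vK va t tab; have tb : t <= b by case/andP: tab.
have ta : a <= t by case/andP: tab.
apply/eqP; rewrite eq_le v0// andbT.
have Ed k s : a <= s <= b -> is_derive s 1 (fun s => v s * expR (k * s))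
   ((dv s + k * v s) * expR (k * s)).
  by move=> sab; der (exact: vd); ring.
case: va => [va|vb].
  move: ta; rewrite (le_eqVlt a) => /predU1P[<-|ta]; first by rewrite va.
  have [|c cat] := @mvt (fun s => v s * expR (- K * s))
    (fun s => (dv s + - K * v s) * expR (- K * s)) a t ta.
    by move=> s /andP[? ?]; apply: Ed; lra.
  rewrite va mul0r subr0 => E.
  have : v t * expR (- K * t) <= 0.
    rewrite E pmulr_lle0 ?subr_gt0// pmulr_lle0 ?expR_gt0//.
    have cab : a <= c <= b by lra.
    by have := vK c cab; have := ler_norm (dv c); lra.
  by rewrite pmulr_lle0 ?expR_gt0.
move: tb; rewrite (le_eqVlt t) => /predU1P[->|tb]; first by rewrite vb.
have [|c cat] := @mvt (fun s => v s * expR (K * s))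
    (fun s => (dv s + K * v s) * expR (K * s)) t b tb.
  by move=> s /andP[? ?]; apply: Ed; lra.
rewrite vb mul0r sub0r => E.
have : - (v t * expR (K * t)) >= 0.
  rewrite E mulr_ge0 ?subr_ge0 ?(ltW tb)// mulr_ge0 ?expR_ge0//.
  have cab : a <= c <= b by lra.
  by have := vK c cab; have := ler_norm (- dv c); rewrite normrN; lra.
by rewrite oppr_ge0 pmulr_lle0 ?expR_gt0.
Qed.

End MeanValue.

(** * Solutions, uniqueness and linear changes of coordinates *)

Section Solutions.
Context {R : realType}.
Implicit Types (F G : R * R -> R * R) (g h : R -> R * R) (f : R * R -> R).

Lemma sol_shift F g s : solution_on setT F g ->
  solution_on setT F (fun t => g (t + s)).
Proof.
have sh (u : R -> R) du t : is_derive (t + s) 1 u du -> is_derive t 1 (fun t => u (t + s)) du.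
  by move=> ud; apply: isd_eq (isd_comp (isdD (isd_id t) (isd_cst t s)) ud) _; ring.
by move=> gF t _; have [g1 g2] := gF (t + s) I; split;
  [exact: (sh (fun t => (g t).1))|exact: (sh (fun t => (g t).2))].
Qed.

Lemma sol_scale F c g : solution_on setT F g ->
  solution_on setT (fun z => (c * (F z).1, c * (F z).2)) (fun t => g (c * t)).
Proof.
have sh (u : R -> R) du t : is_derive (c * t) 1 u du ->
    is_derive t 1 (fun t => u (c * t)) (c * du).
  by move=> ud; apply: isd_eq (isd_comp (isdM (isd_cst t c) (isd_id t)) ud) _; ring.
by move=> gF t _; have [g1 g2] := gF (c * t) I; split;
  [exact: (sh (fun t => (g t).1))|exact: (sh (fun t => (g t).2))].
Qed.

Lemma bounded_segment (f : R -> R) (a b : R) : (forall t, {for t, continuous f}) ->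
  exists M : R, forall t, a <= t <= b -> `|f t| <= M.
Proof.
move=> fc; have [ab|ba] := leP a b; last by exists 0 => t tab; exfalso; lra.
have [c _ cP] : exists2 c, c \in `[a, b] & forall t, t \in `[a, b] -> `|f t| <= `|f c|.
  apply: (@EVT_max R (fun t => `|f t|)) => //.
  apply: continuous_subspaceT => t.
  by apply: (continuous_comp (fc t)); exact: norm_continuous.
by exists `|f c| => t tab; apply: cP; rewrite in_itv.
Qed.

Definition loc_lip f := forall M : R, exists2 K : R, 0 <= K & forall z w : R * R,
  `|z.1| <= M -> `|z.2| <= M -> `|w.1| <= M -> `|w.2| <= M ->
  `|f z - f w| <= K * (`|z.1 - w.1| + `|z.2 - w.2|).

(** Gronwall's lemma for the squared distance [v], on a square that contains both solutions between
    the times 0 and [t]. *)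
Lemma sol_uniq F g h : loc_lip (fun z => (F z).1) -> loc_lip (fun z => (F z).2) ->
  solution_on setT F g -> solution_on setT F h -> g 0 = h 0 -> g =1 h.
Proof.
move=> F1 F2 gF hF gh0 t.
have cont k : solution_on setT F k ->
    (forall s, {for s, continuous (fun s => (k s).1)}) /\
    (forall s, {for s, continuous (fun s => (k s).2)}).
  by move=> kF; split=> s; have [k1 k2] := kF s I; [exact: isd_cont k1|exact: isd_cont k2].
pose a : R := Order.min 0 t; pose b : R := Order.max 0 t.
have [gc1 gc2] := cont g gF; have [hc1 hc2] := cont h hF.
have [M1 gM1] := bounded_segment a b gc1; have [M2 gM2] := bounded_segment a b gc2.
have [M3 hM1] := bounded_segment a b hc1; have [M4 hM2] := bounded_segment a b hc2.
pose M := `|M1| + `|M2| + `|M3| + `|M4|.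
have MM : [/\ M1 <= M, M2 <= M, M3 <= M & M4 <= M].
  have := (ler_norm M1, ler_norm M2, ler_norm M3, ler_norm M4).
  have := (normr_ge0 M1, normr_ge0 M2, normr_ge0 M3, normr_ge0 M4).
  by rewrite /M => -[[[? ?] ?] ?] [[[? ?] ?] ?]; split; lra.
have [MM1 MM2 MM3 MM4] := MM.
have [K1 K10 K1P] := F1 M.
have [K2 K20 K2P] := F2 M.
pose v s := ((g s).1 - (h s).1) ^+ 2 + ((g s).2 - (h s).2) ^+ 2.
pose dv s := 2 * ((g s).1 - (h s).1) * ((F (g s)).1 - (F (h s)).1)
   + 2 * ((g s).2 - (h s).2) * ((F (g s)).2 - (F (h s)).2).
have vd (s : R) : is_derive s 1 v (dv s).
  have [g1 g2] := gF s I; have [h1 h2] := hF s I.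
  by rewrite /v; der eassumption; rewrite /dv; ring.
have v0 (s : R) : 0 <= v s by rewrite addr_ge0// sqr_ge0.
(* With x, y the absolute coordinate differences, x (x + y) and y (x + y) are at most 2 (x^2 + y^2),
   and [dv] carries a factor 2: hence the 4. *)
have vK (s : R) : a <= s <= b -> `|dv s| <= (4 * (K1 + K2)) * v s.
  move=> sab.
  have A1 := le_trans (gM1 _ sab) MM1; have A2 := le_trans (gM2 _ sab) MM2.
  have A3 := le_trans (hM1 _ sab) MM3; have A4 := le_trans (hM2 _ sab) MM4.
  have B1 := K1P (g s) (h s) A1 A2 A3 A4; have B2 := K2P (g s) (h s) A1 A2 A3 A4.
  rewrite /dv /v; apply: le_trans (ler_normD _ _) _; rewrite !normrM ger0_norm//.
  rewrite -(real_normK (num_real ((g s).1 - _))) -(real_normK (num_real ((g s).2 - _))).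
  move: B1 B2; set x := `|(g s).1 - _|; set y := `|(g s).2 - _|.
  set p := `|(F (g s)).1 - _|; set q := `|(F (g s)).2 - _| => B1 B2.
  have x0 : 0 <= x := normr_ge0 _; have y0 : 0 <= y := normr_ge0 _.
  have C1 : x * p <= x * (K1 * (x + y)) by apply: ler_wpM2l.
  have C2 : y * q <= y * (K2 * (x + y)) by apply: ler_wpM2l.
  have D1 : 0 <= K1 * (x - y) ^+ 2 by rewrite mulr_ge0// sqr_ge0.
  have D2 : 0 <= K2 * (x - y) ^+ 2 by rewrite mulr_ge0// sqr_ge0.
  have D3 : 0 <= K1 * (y ^+ 2) by rewrite mulr_ge0// sqr_ge0.
  have D4 : 0 <= K2 * (x ^+ 2) by rewrite mulr_ge0// sqr_ge0.
  have D5 : 0 <= K1 * (x ^+ 2) by rewrite mulr_ge0// sqr_ge0.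
  have D6 : 0 <= K2 * (y ^+ 2) by rewrite mulr_ge0// sqr_ge0.
  by lra.
have vt : v t = 0.
  have v00 : v 0 = 0 by rewrite /v gh0 !subrr expr0n addr0.
  have ab0 : v a = 0 \/ v b = 0.
    by rewrite /a /b; case: (leP 0 t) => _; [left|right].
  have ab : a <= t <= b by rewrite /a /b; case: (leP 0 t) => ?; lra.
  by apply: (@gronwall0 R v dv a b (4 * (K1 + K2))) => //; lra.
move/eqP: vt; rewrite paddr_eq0 ?sqr_ge0// !sqrf_eq0 !subr_eq0 => /andP[/eqP ? /eqP ?].
by rewrite [LHS]surjective_pairing [RHS]surjective_pairing; congr pair.
Qed.

(** The working form of a center: the neighbourhood becomes a square, and time is shifted so that
    the solution starts at the given point. *)
Lemma center_near F z : is_center F z ->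
  exists2 e, 0 < e & forall w, w <> z -> `|w.1 - z.1| < e -> `|w.2 - z.2| < e ->
  exists g T, [/\ solution_on setT F g, 0 < T, forall t, g (t + T) = g t,
    g 0 = w & (forall t, g t <> z) /\ exists t, g t <> w].
Proof.
move=> [_ [A [U [oU _ Uz AE]] AP]].
have /nbhs_ballP[e /= e0 eU] : nbhs z U by exact: open_nbhs_nbhs.
exists e => // w wz w1 w2.
have Aw : A w.
  rewrite AE; split => //; apply: eU.
  by split; rewrite /ball /= distrC.
have [ O [[g [T [gF T0 gT [t tg] OE]]] Ow OA]] := AP _ Aw.
move: Ow; rewrite OE => -[s _ sw].
exists (fun t => g (t + s)), T; split => //.
- exact: sol_shift.
- by move=> r; rewrite addrAC gT.
- by rewrite add0r.
- split=> [r|].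
    have : A (g (r + s)) by apply: OA; rewrite OE; exists (r + s).
    by rewrite AE => -[].
  apply: contrapT => H.
  have gc r : g r = w.
    by apply: contrapT => gr; apply: H; exists (r - s); rewrite subrK.
  by apply: tg; rewrite !gc.
Qed.

Definition lin (a b c d : R) (z : R * R) : R * R :=
  (a * z.1 + b * z.2, c * z.1 + d * z.2).

Lemma continuous_fst : continuous (fun z : R * R => z.1).
Proof. by move=> z; exact: cvg_fst. Qed.

Lemma continuous_snd : continuous (fun z : R * R => z.2).
Proof. by move=> z; exact: cvg_snd. Qed.

Lemma lin_continuous a b c d : continuous (lin a b c d).
Proof.
have cont p q : continuous (fun z : R * R => p * z.1 + q * z.2).
  move=> z; apply: cvgD; apply: cvgM; try exact: cvg_cst.
    exact: continuous_fst.
  exact: continuous_snd.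
by move=> z; exact: (@cvg_pair _ _ _ (nbhs z) (nbhs _) (nbhs _) _ _ _ _ _ (cont a b z) (cont c d z)).
Qed.

Lemma center_conj F G (a b c d a' b' c' d' k : R) z :
  let L := lin a b c d in let L' := lin a' b' c' d' in
  cancel L L' -> cancel L' L -> k != 0 ->
  (forall w, L (F w) = (k * (G (L w)).1, k * (G (L w)).2)) ->
  is_center F z -> is_center G (L z).
Proof.
move=> L L' LK L'K k0 LF [Fz [A [U [oU cU Uz AE]] AP]].
split.
  have := LF z; rewrite /singular_point Fz /L /lin /= !mulr0 addr0 => -[/esym/eqP + /esym/eqP].
  rewrite !mulf_eq0 (negbTE k0) /= => /eqP E1 /eqP E2.
  by rewrite [LHS]surjective_pairing E1 E2.
exists (L' @^-1` A).
  exists (L' @^-1` U); split => //.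
  - by apply: open_comp oU => w _; exact: lin_continuous.
  - rewrite (_ : _ @^-1` _ = L @` U); last first.
      apply/seteqP; split=> w /=; first by exists (L' w) => //; rewrite L'K.
      by move=> [u Uu <-]; rewrite LK.
    apply: connected_continuous_connected => //.
    by apply: continuous_subspaceT; exact: lin_continuous.
  - by rewrite /= LK.
  - rewrite AE; apply/seteqP; split=> w /= [Uw wz]; split => //.
      by move=> wLz; apply: wz; rewrite wLz LK.
    by move=> zw; apply: wz; rewrite -zw L'K.
move=> w /= /AP[ O [[g [T [gF T0 gT [t tg] OE]]] Ow OA]].
exists (L @` O); split.
- exists (fun s => L (g (k^-1 * s))), (`|k| * T); split.
  + move=> s _; have [g1 g2] := @sol_scale _ k^-1 _ gF s I.
    move: g1 g2; have := LF (g (k^-1 * s)); case: (F _) => p q /=.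
    rewrite /L /lin /= => -[E1 E2] g1 g2; split; der eassumption.
      by rewrite -[RHS](mulKf k0) -E1; ring.
    by rewrite -[RHS](mulKf k0) -E2; ring.
  + by rewrite mulr_gt0// normr_gt0.
  (* For negative [k] time is reversed, and the new period [|k| * T] amounts to a shift by [- T]. *)
  + move=> s; rewrite mulrDr mulrA.
    case: (ltgtP k 0) k0 => // k0 _.
      by rewrite ltr0_norm// mulrN mulVf ?lt_eqF// mulN1r -[in RHS](subrK T (_ * s)) gT.
    by rewrite gtr0_norm// mulVf ?gt_eqF// mul1r gT.
  + exists (k * t); rewrite mulKf// mulr0 => /(can_inj LK) //.
  + rewrite OE; apply/seteqP; split=> u /=.
      by move=> [_ [s _ <-] <-]; exists (k * s) => //; rewrite mulKf.
    by move=> [s _ <-]; exists (g (k^-1 * s)) => //; exists (k^-1 * s).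
- by exists (L' w) => //; rewrite L'K.
- by move=> _ [u /OA Au <-] /=; rewrite LK.
Qed.

Definition swap (F : R * R -> R * R) (z : R * R) : R * R :=
  ((F (z.2, z.1)).2, (F (z.2, z.1)).1).

Lemma center_swap F z : is_center F z -> is_center (swap F) (z.2, z.1).
Proof.
have -> : (z.2, z.1) = lin 0 1 1 0 z by rewrite /lin /=; congr pair; ring.
have K : cancel (lin 0 1 1 0) (lin 0 1 1 0).
  by move=> [x y]; rewrite /lin /=; congr pair; ring.
apply: (center_conj K K (oner_neq0 _)) => -[x y].
by rewrite /lin /swap /= !mul0r !mul1r !add0r !addr0.
Qed.

End Solutions.

(** * Vector fields without a center *)

Section NoCenter.
Context {R : realType}.
Implicit Types (F : R * R -> R * R) (g : R -> R * R).

Lemma periodic_shift (A : Type) (f : R -> A) T t : 0 < T ->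
  (forall t, f (t + T) = f t) -> exists2 s, 0 <= s & f s = f t.
Proof.
move=> T0 fT; have fn n : f (t + T *+ n) = f t.
  by elim: n => [|n IHn]; rewrite ?mulr0n ?addr0// mulrSr addrA fT.
exists (t + T *+ Num.bound (`|t| / T)) => //.
have := archi_boundP (divr_ge0 (normr_ge0 t) (ltW T0)).
rewrite ltr_pdivrMr// mulr_natl; have := ler_norm (- t); rewrite normrN.
by move=> *; lra.
Qed.

(** Periodicity extends [trap] to all times. Positivity is then strict: a zero of [u i] would be a
    minimum, with zero derivative, against the inward condition. *)
Lemma periodic_trap (I : finType) (u du : I -> R -> R) (T : R) : 0 < T ->
  (forall i t, u i (t + T) = u i t) ->
  (forall i (t : R), is_derive t 1 (u i) (du i t)) ->
  (forall i, 0 <= u i 0) ->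
  (forall i t, (forall j, 0 <= u j t) -> u i t = 0 -> 0 < du i t) ->
  forall i t, 0 < u i t.
Proof.
move=> T0 uT ud u0 uP.
have u_ge0 i t : 0 <= u i t.
  have [s s0 <-] := periodic_shift t T0 (uT i).
  by apply: (trap ud u0) => // {}i r _; exact: uP.
move=> i t; rewrite lt_def u_ge0 andbT; apply/eqP => uit.
have := uP i t (fun j => u_ge0 j t) uit; rewrite (isd_min0 (ud i t)) ?ltxx//.
by move=> s; rewrite uit.
Qed.

(** Here [DU] is the derivative of [U] along the flow. The condition is required only off the
    origin, which the orbits around the center avoid; the origin may thus be a corner of the
    region. *)
Lemma trap_center (I : finType) (U DU : I -> R * R -> R) F :
  (forall g, solution_on setT F g -> forall i (t : R),
     is_derive t 1 (fun s => U i (g s)) (DU i (g t))) ->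
  (forall i z, z <> (0, 0) -> (forall j, 0 <= U j z) -> U i z = 0 -> 0 < DU i z) ->
  is_center F (0, 0) ->
  exists2 e, 0 < e & forall w, w <> (0, 0) -> `|w.1| < e -> `|w.2| < e ->
  (forall j, 0 <= U j w) ->
  exists g T, [/\ solution_on setT F g, 0 < T, forall t, g (t + T) = g t, g 0 = w &
    forall i t, 0 < U i (g t)].
Proof.
move=> UD UP /center_near[e e0 eP]; exists e => // w w0 w1 w2 Uw.
have [||g [T [gF T0 gT g0 [gn0 _]]]] := eP w w0; rewrite /= ?subr0//.
exists g, T; split => //; apply: (@periodic_trap _ _ (fun i t => DU i (g t)) T T0).
- by move=> i t; rewrite gT.
- exact: UD.
- by rewrite g0.
- by move=> i t; apply: UP.
Qed.

Lemma periodic_speed0 (f df : R -> R) (T : R) : 0 < T ->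
  (forall t, f (t + T) = f t) -> (forall t : R, is_derive t 1 f (df t)) ->
  exists t, df t = 0.
Proof.
move=> T0 fT fd; have [c _ ] := mvt T0 (fun t _ => fd t).
have := fT 0; rewrite add0r => ->; rewrite subrr subr0 => /esym/eqP.
by rewrite mulf_eq0 (gt_eqF T0) orbF => /eqP; exists c.
Qed.

(** The half plane x >= 0 is trapping, so a periodic orbit starting on its boundary would have x > 0
    already at time 0. *)
Lemma no_center_one_way F : (forall y, y <> 0 -> 0 < (F (0, y)).1) ->
  ~ is_center F (0, 0).
Proof.
move=> Fy; pose U := fun (_ : unit) (z : R * R) => z.1.
case/(@trap_center unit U (fun _ z => (F z).1)).
- by move=> g gF [] t; have [] := gF t I.
- move=> [] [x y] z0 _ /= x0; rewrite x0; apply: Fy => y0.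
  by apply: z0; rewrite x0 y0.
move=> e e0 /(_ (0, e / 2)); rewrite /= normr0 gtr0_norm ?divr_gt0//.
have e2 : e / 2 < e by lra.
case=> // [[] /eqP|g [T [_ _ _ g0 /(_ tt 0)]]].
  by rewrite gt_eqF ?divr_gt0.
by rewrite /U g0 ltxx.
Qed.

(** Same contradiction for the closed first quadrant, with a starting point on the positive
    y-axis. *)
Lemma no_center_quadrant F : (forall y, 0 < y -> 0 < (F (0, y)).1) ->
  (forall x, 0 < x -> 0 < (F (x, 0)).2) -> ~ is_center F (0, 0).
Proof.
move=> Fy Fx; pose U := fun (b : bool) (z : R * R) => if b then z.1 else z.2.
case/(@trap_center bool U (fun b z => if b then (F z).1 else (F z).2)).
- by move=> g gF [] t; have [] := gF t I.
- move=> b [x y] z0 Uz; have /= x0 := Uz true; have /= y0 := Uz false.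
  case: b => /= E; rewrite E.
    by apply: Fy; rewrite lt_def y0 andbT; apply/eqP => yy; apply: z0; rewrite E yy.
  by apply: Fx; rewrite lt_def x0 andbT; apply/eqP => xx; apply: z0; rewrite E xx.
move=> e e0 /(_ (0, e / 2)); rewrite /= normr0 gtr0_norm ?divr_gt0//.
have e2 : e / 2 < e by lra.
case=> // [[] /eqP|[]//=|g [T [_ _ _ g0 /(_ true 0)]]].
- by rewrite gt_eqF ?divr_gt0.
- by rewrite divr_ge0// ltW.
- by rewrite /U g0 ltxx.
Qed.

Lemma isd0_cst (f : R -> R) : (forall t : R, is_derive t 1 f 0) -> forall t, f t = f 0.
Proof.
have le (h : R -> R) s t : (forall t : R, is_derive t 1 h 0) -> s <= t -> h s <= h t.
  by move=> hd; apply: (isd_ge0_homo hd).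
move=> fd t; apply/eqP; rewrite eq_le.
have fN (s : R) : is_derive s 1 (fun t => - f t) 0 by der (exact: fd); rewrite oppr0.
case: (leP 0 t) => [|/ltW] t0.
  by rewrite (le f 0 t)// andbT -lerN2 (le (fun t => - f t)).
by rewrite (le f t 0)//= -lerN2 (le (fun t => - f t)).
Qed.

(** The y-axis is invariant, and on it the motion obeys the scalar equation y' = b y^j, whose
    periodic solutions are constant. *)
Lemma no_center_axis F b j : loc_lip (fun z => (F z).1) ->
  (forall y, F (0, y) = (0, b * y ^+ j)) -> ~ is_center F (0, 0).
Proof.
move=> Flip Fy /center_near[e e0] /(_ (0, e / 2)).
rewrite /= !subr0 normr0 gtr0_norm ?divr_gt0//.
have e2 : e / 2 < e by lra.
case=> // [[] /eqP|g [T [gF T0 gT g0 [_ [t0 gt0]]]]].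
  by rewrite gt_eqF ?divr_gt0.
have x0 t : (g t).1 = 0.
  have c1 s : {for s, continuous (fun s => (g s).1)}.
    by have [g1 _] := gF s I; exact: isd_cont g1.
  have c2 s : {for s, continuous (fun s => (g s).2)}.
    by have [_ g2] := gF s I; exact: isd_cont g2.
  pose p : R := Order.min 0 t; pose q : R := Order.max 0 t.
  have [M1 H1] := bounded_segment p q c1; have [M2 H2] := bounded_segment p q c2.
  (* The comparison point is the projection on the axis, where the first component vanishes: the
     Lipschitz bound becomes |x'| <= K |x|. The 0 in the maximum admits the abscissa of that
     point. *)
  have [K K0 KP] := Flip (Order.max M1 (Order.max 0 M2)).
  have vd (s : R) : is_derive s 1 (fun s => (g s).1 ^+ 2) (2 * (g s).1 * (F (g s)).1).
    by have [g1 _] := gF s I; der eassumption; ring.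
  have v00 : (g 0).1 ^+ 2 = 0 by rewrite g0 expr0n.
  have pq0 : (g p).1 ^+ 2 = 0 \/ (g q).1 ^+ 2 = 0.
    by rewrite /p /q; case: (leP 0 t) => _; [left|right].
  have pq : p <= t <= q by rewrite /p /q; case: (leP 0 t) => ?; lra.
  apply/eqP; rewrite -sqrf_eq0; apply/eqP.
  apply: (@gronwall0 R (fun s => (g s).1 ^+ 2) _ p q (2 * K)) => //; first by lra.
    by move=> s _; rewrite sqr_ge0.
  move=> s spq; have := KP (g s) (0, (g s).2); rewrite /= Fy /= subrr normr0 addr0 !subr0.
  rewrite !le_max lexx (H1 _ spq) (H2 _ spq) !orbT => /(_ isT isT isT isT) B.
  rewrite !normrM ger0_norm// -(real_normK (num_real (g s).1)).
  have := ler_wpM2l (normr_ge0 (g s).1) B; rewrite expr2; lra.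
have yd (t : R) : is_derive t 1 (fun s => (g s).2) (b * (g t).2 ^+ j).
  have [_] := gF t I.
  by rewrite (surjective_pairing (g t)) x0 Fy.
have y0 : forall t, (b * (g t).2 ^+ j) ^+ 2 = 0.
  (* This primitive of [b * y ^+ j] has derivative [(b * y ^+ j) ^+ 2] along the motion. *)
  apply: (@periodic_isd_eq0 _ (fun s => b / j.+1%:R * (g s).2 ^+ j.+1) _ T T0).
  - by move=> t; rewrite gT.
  - move=> t; der (exact: yd).
    have jn : j.+1%:R != 0 :> R by rewrite pnatr_eq0.
    by rewrite mul0r add0r; field.
  - by move=> t; rewrite sqr_ge0.
apply: gt0; rewrite [LHS]surjective_pairing x0; congr pair.
have -> : e / 2 = (g 0).2 by rewrite g0.
apply: (@isd0_cst (fun s => (g s).2)) => t.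
by move/eqP: (y0 t); rewrite sqrf_eq0 => /eqP E; rewrite -E.
Qed.

End NoCenter.

Ltac pos := repeat first [assumption | exact: ltr0Sn | apply: exprn_gt0 | apply: mulr_gt0 | apply: divr_gt0].

(** * Reflections, and trapping regions around a nullcline *)

Section TrappingRegions.
Context {R : realType}.
Implicit Types (F : R * R -> R * R) (g : R -> R * R) (a b c d : R).

(** The signs [s1], [s2] reflect the coordinates and [k] reverses time; this normalizes the signs of
    the coefficients. *)
Lemma center_signs (k s1 s2 : R) F : k * k = 1 -> s1 * s1 = 1 -> s2 * s2 = 1 ->
  is_center F (0, 0) ->
  is_center (fun z => (k * s1 * (F (s1 * z.1, s2 * z.2)).1,
                       k * s2 * (F (s1 * z.1, s2 * z.2)).2)) (0, 0).
Proof.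
move=> kk ss1 ss2.
have {2}-> : ((0, 0) : R * R) = lin s1 0 0 s2 (0, 0).
  by rewrite /lin /=; congr pair; ring.
have K : cancel (lin s1 0 0 s2) (lin s1 0 0 s2).
  move=> [x y]; rewrite /lin /=; congr pair.
    by rewrite -[RHS]mul1r -ss1; ring.
  by rewrite -[RHS]mul1r -ss2; ring.
apply: (center_conj K K (k := k)); first by apply/eqP => k0; move/eqP: kk; rewrite k0 mul0r eq_sym oner_eq0.
move=> [x y]; rewrite /lin /= !mul0r !addr0 !add0r !mulrA ss1 ss2 !mul1r.
by rewrite kk !mul1r.
Qed.

Lemma exprS_le (x : R) n : 0 <= x -> x <= 1 -> x ^+ n.+1 <= x.
Proof. by move=> x0 x1; rewrite exprS ler_piMr ?exprn_ile1. Qed.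

Lemma small_factor (M e : R) : 0 <= M -> 0 < e ->
  exists x, [/\ 0 < x, x <= 1 & M * x < e].
Proof.
move=> M0 e0; exists (Order.min 1 (e / (M + 1))).
have h : 0 < e / (M + 1) by rewrite divr_gt0//; lra.
split; first by rewrite lt_min ltr01.
  by rewrite ge_min lexx.
apply: (@le_lt_trans _ _ (M * (e / (M + 1)))).
  by rewrite ler_wpM2l// ge_min lexx orbT.
rewrite mulrA ltr_pdivrMr; last by lra.
by rewrite mulrDr mulr1 [M * e]mulrC; lra.
Qed.

(** By Rolle's theorem the abscissa of a periodic solution has a critical time, which the third
    condition forbids in the region. The last one provides points of the region as close to the
    origin as desired. *)
Lemma no_center_first0 F (J : finType) (U DU : J -> R * R -> R) :
  (forall g, solution_on setT F g -> forall i (t : R),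
     is_derive t 1 (fun s => U i (g s)) (DU i (g t))) ->
  (forall i z, z <> (0, 0) -> (forall j, 0 <= U j z) -> U i z = 0 -> 0 < DU i z) ->
  (forall z, (forall i, 0 < U i z) -> (F z).1 <> 0) ->
  (forall e, 0 < e -> exists w, [/\ w <> (0, 0), `|w.1| < e, `|w.2| < e &
    forall i, 0 <= U i w]) ->
  ~ is_center F (0, 0).
Proof.
move=> UD UP UF Uw /(trap_center UD UP)[e e0 eP].
have [w [w0 w1 w2 wU]] := Uw e e0.
have [g [T [gF T0 gT g0 gU]]] := eP w w0 w1 w2 wU.
have [t|t|t] := @periodic_speed0 _ (fun t => (g t).1) (fun t => (F (g t)).1) T T0.
- by rewrite gT.
- by have [] := gF t I.
- exact: UF.
Qed.

(* The region [k x^2 < y < K x^2], [x < e] surrounds the branch [c y = d x^2] of a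
   nullcline; the flow cannot leave it, and there [x] decreases. *)
Lemma no_center_weights12_aux a c d : 0 < a -> 0 < c -> 0 < d ->
  ~ is_center (fun z => (- a * z.2 ^+ 3, - c * z.1 * z.2 + d * z.1 ^+ 3)) (0, 0).
Proof.
move=> a0 c0 d0; pose K := 2 * d / c; pose k := d / (2 * c).
have K0 : 0 < K by rewrite divr_gt0// mulr_gt0.
have k0 : 0 < k by rewrite divr_gt0// mulr_gt0.
have cK : c * K = 2 * d by rewrite /K; field; rewrite gt_eqF.
have ck : 2 * c * k = d by rewrite /k; field; rewrite gt_eqF.
(* On the upper parabola the inward derivative is x^3 (d - 2 a K^4 x^4); this [e] keeps it positive
   for x <= e. *)
have [e [e0 e1 eP]] := small_factor (ltW (mulr_gt0 (mulr_gt0 (ltr0Sn R 1) a0) (exprn_gt0 4 K0))) d0.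
pose P (z : R * R) := - a * z.2 ^+ 3; pose Q (z : R * R) := - c * z.1 * z.2 + d * z.1 ^+ 3.
pose U (i : bool * bool) (z : R * R) := match i with
  | (true, true) => z.1 | (true, false) => e - z.1
  | (false, true) => K * z.1 ^+ 2 - z.2 | (false, false) => z.2 - k * z.1 ^+ 2 end.
pose DU (i : bool * bool) (z : R * R) := match i with
  | (true, true) => P z | (true, false) => - P z
  | (false, true) => 2 * K * z.1 * P z - Q z | (false, false) => Q z - 2 * k * z.1 * P z end.
apply: (@no_center_first0 _ _ U DU).
- move=> g gF i t; have [/= g1 g2] := gF t I.
  by case: i => [[] []] /=; [eassumption|der eassumption..]; rewrite /P /Q; ring.
- move=> i [x y] z0 Uz.
  have /= u1 := Uz (true, true); have /= u2 := Uz (true, false).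
  have /= u3 := Uz (false, true); have /= u4 := Uz (false, false).
  have x0 : 0 < x.
    rewrite lt_def u1 andbT; apply/eqP => xx; apply: z0.
    by move: u3 u4; rewrite xx expr0n /= !mulr0 => u3 u4; congr pair; lra.
  have x3 : 0 < x ^+ 3 by rewrite exprn_gt0.
  have y0 : 0 < y by have := mulr_gt0 k0 (exprn_gt0 2 x0); lra.
  have y3 : 0 < a * y ^+ 3 by rewrite mulr_gt0// exprn_gt0.
  case: i => [[] []] /= E; rewrite /P /Q /=.
  + by rewrite E ltxx in x0.
  + by rewrite mulNr opprK.
  + have -> : y = K * x ^+ 2 by lra.
    have -> : 2 * K * x * (- a * (K * x ^+ 2) ^+ 3) - (- c * x * (K * x ^+ 2) + d * x ^+ 3)
      = x ^+ 3 * ((c * K) - d - 2 * a * K ^+ 4 * x ^+ 4) by ring.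
    rewrite cK mulr_gt0//.
    have : 2 * a * K ^+ 4 * x ^+ 4 <= 2 * a * K ^+ 4 * e.
      apply: ler_wpM2l; first exact: (ltW (mulr_gt0 (mulr_gt0 (ltr0Sn R 1) a0) (exprn_gt0 4 K0))).
      by apply: le_trans (_ : x <= _); [apply: exprS_le; lra|lra].
    by lra.
  + have -> : y = k * x ^+ 2 by lra.
    have -> : - c * x * (k * x ^+ 2) + d * x ^+ 3 - 2 * k * x * (- a * (k * x ^+ 2) ^+ 3)
      = x ^+ 3 * (d - c * k + 2 * a * k ^+ 4 * x ^+ 4) by ring.
    rewrite mulr_gt0//.
    have : 0 < 2 * a * k ^+ 4 * x ^+ 4 by pos.
    by lra.
- move=> [x y] Uz.
  have /= u1 := Uz (true, true); have /= u4 := Uz (false, false).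
  have y0 : 0 < y by have := mulr_gt0 k0 (exprn_gt0 2 u1); lra.
  by apply/eqP; rewrite lt_eqF// mulNr oppr_lt0 mulr_gt0// exprn_gt0.
- move=> r r0; have dc : 0 < d / c by rewrite divr_gt0.
  (* The starting point is on the nullcline itself; the factor [1 + d / c] bounds both of its
     coordinates. *)
  have M0 : 0 <= 1 + d / c by lra.
  have re0 : 0 < Order.min r e by rewrite lt_min r0.
  have [x [x0 x1]] := small_factor M0 re0.
  rewrite lt_min mulrDl mul1r => /andP[xr xe].
  have dcx : 0 < d / c * x by rewrite mulr_gt0.
  have x2 : 0 < x ^+ 2 by rewrite exprn_gt0.
  have dx2 : d / c * x ^+ 2 <= d / c * x by apply: ler_wpM2l; [exact: ltW|apply: exprS_le; rewrite // ltW].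
  have dcx2 : 0 < d / c * x ^+ 2 by rewrite mulr_gt0.
  exists (x, d / c * x ^+ 2); split => /=.
  + by case => xx; rewrite xx ltxx in x0.
  + by rewrite gtr0_norm//; lra.
  + by rewrite gtr0_norm//; lra.
  + have KE : K * x ^+ 2 = 2 * (d / c * x ^+ 2) by rewrite /K; ring.
    have kE : k * x ^+ 2 = (d / c * x ^+ 2) / 2 by rewrite /k; field; rewrite gt_eqF.
    by case=> [[] []] /=; rewrite ?KE ?kE; lra.
Qed.

(* Same argument with [k x^3 < y^2 < K x^3], around [c y^2 = d x^3]. *)
Lemma no_center_weights23_aux a c d : 0 < a -> 0 < c -> 0 < d ->
  ~ is_center (fun z => (- a * z.2 ^+ 3, - c * z.2 ^+ 2 + d * z.1 ^+ 3)) (0, 0).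
Proof.
move=> a0 c0 d0; pose K := 2 * d / c; pose k := d / (2 * c).
have K0 : 0 < K by rewrite divr_gt0// mulr_gt0.
have k0 : 0 < k by rewrite divr_gt0// mulr_gt0.
have cK : c * K = 2 * d by rewrite /K; field; rewrite gt_eqF.
have ck : 2 * c * k = d by rewrite /k; field; rewrite gt_eqF.
have M0 : 0 <= 3 * a * K ^+ 2 := ltW (mulr_gt0 (mulr_gt0 (ltr0Sn R 2) a0) (exprn_gt0 2 K0)).
(* On the face with [K] the inward derivative is y x^3 (2 d - 3 a K^2 x^2), positive for this choice
   of [e]. *)
have [e [e0 e1 eP]] := small_factor M0 d0.
pose P (z : R * R) := - a * z.2 ^+ 3; pose Q (z : R * R) := - c * z.2 ^+ 2 + d * z.1 ^+ 3.
pose U (i : bool * bool) (z : R * R) := match i with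
  | (true, true) => z.2 | (true, false) => e - z.1
  | (false, true) => K * z.1 ^+ 3 - z.2 ^+ 2 | (false, false) => z.2 ^+ 2 - k * z.1 ^+ 3 end.
pose DU (i : bool * bool) (z : R * R) := match i with
  | (true, true) => Q z | (true, false) => - P z
  | (false, true) => 3 * K * z.1 ^+ 2 * P z - 2 * z.2 * Q z
  | (false, false) => 2 * z.2 * Q z - 3 * k * z.1 ^+ 2 * P z end.
apply: (@no_center_first0 _ _ U DU).
- move=> g gF i t; have [/= g1 g2] := gF t I.
  by case: i => [[] []] /=; [eassumption|der eassumption..]; rewrite /P /Q; ring.
- move=> i [x y] z0 Uz.
  have /= u1 := Uz (true, true); have /= u2 := Uz (true, false).
  have /= u3 := Uz (false, true); have /= u4 := Uz (false, false).
  have x3 : 0 <= x ^+ 3.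
    have := sqr_ge0 y; have := pmulr_rge0 (x ^+ 3) K0; move=> <-; lra.
  have x0' : 0 <= x by move: x3; rewrite exprn_odd_ge0.
  have y0 : 0 < y.
    rewrite lt_def u1 andbT; apply/eqP => yy; apply: z0; rewrite yy; congr pair.
    move: u4; rewrite yy expr0n /= sub0r oppr_ge0 pmulr_rle0// => u4.
    apply/eqP; rewrite -[_ == 0](@expf_eq0 _ x 3); apply/eqP; lra.
  have x0 : 0 < x.
    rewrite lt_def x0' andbT; apply/eqP => xx.
    by move: u3; rewrite xx expr0n /= mulr0 sub0r oppr_ge0 leNgt exprn_gt0.
  have y3 : 0 < a * y ^+ 3 by rewrite mulr_gt0// exprn_gt0.
  have {}x3 : 0 < x ^+ 3 by rewrite exprn_gt0.
  have x2e : x ^+ 2 <= e.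
    by apply: le_trans (_ : x <= _); [apply: exprS_le; lra|lra].
  case: i => [[] []] /= E; rewrite /P /Q /=.
  + by rewrite E ltxx in y0.
  + by rewrite mulNr opprK.
  + have E2 : y ^+ 2 = K * x ^+ 3 by lra.
    have -> : 3 * K * x ^+ 2 * (- a * y ^+ 3) - 2 * y * (- c * y ^+ 2 + d * x ^+ 3)
      = y * (2 * c * y ^+ 2 - 2 * d * x ^+ 3 - 3 * K * a * x ^+ 2 * y ^+ 2) by ring.
    rewrite E2.
    have -> : y * (2 * c * (K * x ^+ 3) - 2 * d * x ^+ 3 - 3 * K * a * x ^+ 2 * (K * x ^+ 3))
      = y * x ^+ 3 * (2 * (c * K) - 2 * d - 3 * a * K ^+ 2 * x ^+ 2) by ring.
    rewrite cK mulr_gt0// ?mulr_gt0//.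
    by have := ler_wpM2l M0 x2e; lra.
  + have E2 : y ^+ 2 = k * x ^+ 3 by lra.
    have -> : 2 * y * (- c * y ^+ 2 + d * x ^+ 3) - 3 * k * x ^+ 2 * (- a * y ^+ 3)
      = y * (2 * d * x ^+ 3 - 2 * c * y ^+ 2 + 3 * k * a * x ^+ 2 * y ^+ 2) by ring.
    rewrite E2.
    have -> : y * (2 * d * x ^+ 3 - 2 * c * (k * x ^+ 3) + 3 * k * a * x ^+ 2 * (k * x ^+ 3))
      = y * x ^+ 3 * (2 * d - 2 * c * k + 3 * k * a * k * x ^+ 2) by ring.
    rewrite ck mulr_gt0// ?mulr_gt0//.
    have : 0 < 3 * k * a * k * x ^+ 2 by pos.
    by lra.
- move=> [x y] Uz; have /= y0 := Uz (true, true).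
  by apply/eqP; rewrite lt_eqF// mulNr oppr_lt0 mulr_gt0// exprn_gt0.
- move=> r r0; have dc : 0 < d / c by rewrite divr_gt0.
  have re0 : 0 < Order.min r e by rewrite lt_min r0.
  have M0' : 0 <= 1 + d / c + (d / c) ^+ 2 by rewrite addr_ge0 ?sqr_ge0//; lra.
  (* [(m x^2, m^2 x^3)] with [m = d / c] lies on the nullcline [c y^2 = d x^3] *)
  have [x [x0 x1]] := small_factor M0' re0.
  rewrite lt_min !mulrDl mul1r => /andP[xr xe].
  have dcx : 0 < d / c * x by rewrite mulr_gt0.
  have dcx2 : 0 < (d / c) ^+ 2 * x by rewrite mulr_gt0 ?exprn_gt0.
  have x2 : d / c * x ^+ 2 <= d / c * x by apply: ler_wpM2l; [exact: ltW|apply: exprS_le; rewrite // ltW].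
  have x3 : (d / c) ^+ 2 * x ^+ 3 <= (d / c) ^+ 2 * x.
    by apply: ler_wpM2l; [exact: sqr_ge0|apply: exprS_le; rewrite // ltW].
  have A1 : 0 < d / c * x ^+ 2 by rewrite mulr_gt0 ?exprn_gt0.
  have A2 : 0 < (d / c) ^+ 2 * x ^+ 3 by rewrite mulr_gt0 ?exprn_gt0.
  have A3 : 0 < (d / c) ^+ 4 * x ^+ 6 by rewrite mulr_gt0 ?exprn_gt0.
  exists (d / c * x ^+ 2, (d / c) ^+ 2 * x ^+ 3); split => /=.
  + by case => xx; rewrite xx ltxx in A1.
  + by rewrite gtr0_norm//; lra.
  + by rewrite gtr0_norm//; lra.
  + have YE : ((d / c) ^+ 2 * x ^+ 3) ^+ 2 = (d / c) ^+ 4 * x ^+ 6 by ring.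
    have KE : K * (d / c * x ^+ 2) ^+ 3 = 2 * ((d / c) ^+ 4 * x ^+ 6) by rewrite /K; ring.
    have kE : k * (d / c * x ^+ 2) ^+ 3 = ((d / c) ^+ 4 * x ^+ 6) / 2.
      by rewrite /k; field; rewrite gt_eqF.
    by case=> [[] []] /=; rewrite ?KE ?kE ?YE; lra.
Qed.

End TrappingRegions.

(** * The four families without a center *)

Section NoCenterFamilies.
Context {R : realType}.
Implicit Types (F : R * R -> R * R) (g : R -> R * R) (a b c d : R).

Lemma center_ext F G z : F =1 G -> is_center F z -> is_center G z.
Proof. by move=> /funext ->. Qed.

(** Along a periodic orbit the nondecreasing [V] is constant, so [DV] vanishes there, in particular
    at the starting point [w]. *)
Lemma no_center_lyapunov F (V DV : R * R -> R) :
  (forall g, solution_on setT F g -> forall t : R,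
     is_derive t 1 (fun s => V (g s)) (DV (g t))) ->
  (forall z, 0 <= DV z) ->
  (forall e, 0 < e -> exists w, [/\ w <> (0, 0), `|w.1| < e, `|w.2| < e & DV w <> 0]) ->
  ~ is_center F (0, 0).
Proof.
move=> VD V0 Vw /center_near[e e0 eP]; have [w [w0 w1 w2 wV]] := Vw e e0.
have [||g [T [gF T0 gT g0 _]]] := eP w w0; rewrite /= ?subr0//.
apply: wV; rewrite -g0.
apply: (@periodic_isd_eq0 _ (fun t => V (g t)) (fun t => DV (g t)) T) => //.
  by move=> t; rewrite gT.
exact: VD.
Qed.

Lemma no_center_weights12 a c d : a * d < 0 -> c != 0 ->
  ~ is_center (fun z => (a * z.2 ^+ 3, c * z.1 * z.2 + d * z.1 ^+ 3)) (0, 0).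
Proof.
have aneg a' c' d' : a' < 0 -> 0 < d' -> c' != 0 ->
    ~ is_center (fun z => (a' * z.2 ^+ 3, c' * z.1 * z.2 + d' * z.1 ^+ 3)) (0, 0).
  move=> a0 d0 c0 H; have a0' : 0 < - a' by rewrite oppr_gt0.
  case: (ltgtP c' 0) c0 => // c0 _.
    have c0' : 0 < - c' by rewrite oppr_gt0.
    apply: (no_center_weights12_aux a0' c0' d0); apply: center_ext H => -[x y] /=.
    by rewrite !opprK.
  apply: (no_center_weights12_aux a0' c0 d0).
  (* Reversing time and y changes the sign of [c'] alone. *)
  apply: center_ext (@center_signs R (-1) 1 (-1) _ _ _ _ H) => [-[x y] /=|||]; last 3 first.
  - by ring.
  - by ring.
  - by ring.
  by congr pair; ring.
move=> ad c0 H; case: (ltgtP a 0) => a0.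
- have d0 : 0 < d by move: ad; rewrite nmulr_rlt0.
  exact: aneg a0 d0 c0 H.
- have a0' : - a < 0 by rewrite oppr_lt0.
  have d0 : 0 < - d by move: ad; rewrite pmulr_rlt0// oppr_gt0.
  have c0' : - c != 0 by rewrite oppr_eq0.
  apply: (aneg _ _ _ a0' d0 c0').
  apply: center_ext (@center_signs R (-1) 1 1 _ _ _ _ H) => [-[x y] /=|||]; last 3 first.
  - by ring.
  - by ring.
  - by ring.
  by congr pair; ring.
- by move: ad; rewrite a0 mul0r ltxx.
Qed.

Lemma no_center_weights23 a c d : a * d < 0 -> c != 0 ->
  ~ is_center (fun z => (a * z.2 ^+ 3, c * z.2 ^+ 2 + d * z.1 ^+ 3)) (0, 0).
Proof.
have aneg a' c' d' : a' < 0 -> 0 < d' -> c' != 0 ->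
    ~ is_center (fun z => (a' * z.2 ^+ 3, c' * z.2 ^+ 2 + d' * z.1 ^+ 3)) (0, 0).
  move=> a0 d0 c0 H; have a0' : 0 < - a' by rewrite oppr_gt0.
  case: (ltgtP c' 0) c0 => // c0 _.
    have c0' : 0 < - c' by rewrite oppr_gt0.
    apply: (no_center_weights23_aux a0' c0' d0); apply: center_ext H => -[x y] /=.
    by rewrite !opprK.
  apply: (no_center_weights23_aux a0' c0 d0).
  (* Reversing time and x changes the sign of [c'] alone. *)
  apply: center_ext (@center_signs R (-1) (-1) 1 _ _ _ _ H) => [-[x y] /=|||]; last 3 first.
  - by ring.
  - by ring.
  - by ring.
  by congr pair; ring.
move=> ad c0 H; case: (ltgtP a 0) => a0.
- have d0 : 0 < d by move: ad; rewrite nmulr_rlt0.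
  exact: aneg a0 d0 c0 H.
- have a0' : - a < 0 by rewrite oppr_lt0.
  have d0 : 0 < - d by move: ad; rewrite pmulr_rlt0// oppr_gt0.
  have c0' : - c != 0 by rewrite oppr_eq0.
  apply: (aneg _ _ _ a0' d0 c0').
  apply: center_ext (@center_signs R (-1) 1 1 _ _ _ _ H) => [-[x y] /=|||]; last 3 first.
  - by ring.
  - by ring.
  - by ring.
  by congr pair; ring.
- by move: ad; rewrite a0 mul0r ltxx.
Qed.

(** Up to a factor, the monotone function is the energy of the Hamiltonian system obtained for c =
    0; the term c y makes it change at the rate a c y^4, and the factor [a * c] fixes the sign. *)
Lemma no_center_weights13_cubic a c d : a != 0 -> c != 0 ->
  ~ is_center (fun z => (a * z.2 ^+ 3, c * z.2 + d * z.1 ^+ 3)) (0, 0).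
Proof.
move=> a0 c0; apply: (@no_center_lyapunov _
  (fun z => a * c / 4 * (a * z.2 ^+ 4 - d * z.1 ^+ 4)) (fun z => (a * c) ^+ 2 * z.2 ^+ 4)).
- by move=> g gF t; have [/= g1 g2] := gF t I; der eassumption; field.
- by move=> z; rewrite mulr_ge0 ?exprn_even_ge0.
- move=> e e0; have e2 : 0 < e / 2 by rewrite divr_gt0.
  exists (0, e / 2); rewrite /= normr0 gtr0_norm//; split => //.
  + by case=> /eqP; rewrite gt_eqF.
  + by lra.
  + by apply/eqP; rewrite !mulf_neq0 ?expf_neq0 ?mulf_neq0// gt_eqF.
Qed.

(* The flow cannot leave the region where [x] and its derivative are both positive. *)
Lemma no_center_weights13_saddle a b c d : a != 0 -> 0 < a * d - b * c ->
  ~ is_center (fun z => (a * z.2 + b * z.1 ^+ 3, c * z.2 + d * z.1 ^+ 3)) (0, 0).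
Proof.
move=> a0 k0.
pose P (z : R * R) := a * z.2 + b * z.1 ^+ 3; pose Q (z : R * R) := c * z.2 + d * z.1 ^+ 3.
pose U (i : bool) (z : R * R) := if i then z.1 else P z.
pose DU (i : bool) (z : R * R) := if i then P z else a * Q z + 3 * b * z.1 ^+ 2 * P z.
apply: (@no_center_first0 _ _ _ U DU).
- move=> g gF i t; have [/= g1 g2] := gF t I.
  by case: i => /=; [eassumption|rewrite /P; der eassumption]; rewrite /P /Q; ring.
- move=> i [x y] z0 Uz; have /= u1 := Uz true; have /= u2 := Uz false.
  have ay0 : x = 0 -> P (x, y) = 0 -> False.
    rewrite /P /= => xx; rewrite xx expr0n /= mulr0 addr0 => /eqP.
    by rewrite mulf_eq0 (negbTE a0) /= => /eqP yy; apply: z0; rewrite xx yy.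
  case: i => /= E.
    by rewrite lt_def u2 andbT; apply/eqP => /ay0; apply.
  have x0 : 0 < x by rewrite lt_def u1 andbT; apply/eqP => xx; exact: ay0 xx E.
  rewrite E mulr0 addr0 /Q /=; move: E; rewrite /P /= => E.
  (* Where x' = 0, the second derivative of x is (ad - bc) x^3. *)
  have -> : a * (c * y + d * x ^+ 3) = c * (a * y + b * x ^+ 3) + (a * d - b * c) * x ^+ 3 by ring.
  by rewrite E mulr0 add0r; pos.
- move=> z Uz; have /= u2 := Uz false; apply/eqP; rewrite gt_eqF//.
- move=> r r0; have aa : 0 < `|a| by rewrite normr_gt0.
  have bb : 0 <= `|b| := normr_ge0 _.
  have M0 : 0 <= 1 + (1 + `|b|) / `|a| by rewrite addr_ge0 ?divr_ge0//; lra.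
  have [x [x0 x1]] := small_factor M0 r0.
  rewrite mulrDl mul1r => xr.
  have A : 0 <= (1 + `|b|) / `|a| * x by rewrite mulr_ge0 ?divr_ge0//; lra.
  (* This ordinate solves a y + b x^3 = x. *)
  exists (x, (x - b * x ^+ 3) / a); split => /=.
  + by case => xx; rewrite xx ltxx in x0.
  + by rewrite gtr0_norm//; lra.
  + rewrite normrM normfV; apply: (@le_lt_trans _ _ ((1 + `|b|) / `|a| * x)); last lra.
    rewrite mulrAC ler_wpM2r ?invr_ge0//.
    apply: le_trans (ler_normB _ _) _; rewrite normrM normrX (gtr0_norm x0).
    have x3 : x ^+ 3 <= x by apply: exprS_le => //; exact: ltW.
    by have := ler_wpM2l bb x3; lra.
  + case=> /=; first exact: ltW.
    by rewrite /P /= mulrC divfK// subrK ltW.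
Qed.

(* The region [|y - m x^3| < del x^3], [x < e] surrounds the nullcline [c y + d x^3 = 0]. *)
Lemma no_center_weights13_node_aux a b c d : c < 0 -> a * d - b * c < 0 ->
  ~ is_center (fun z => (a * z.2 + b * z.1 ^+ 3, c * z.2 + d * z.1 ^+ 3)) (0, 0).
Proof.
move=> c0 k0; pose m := - d / c.
have c0' : c != 0 by rewrite lt_eqF.
have mc : c * m = - d by rewrite /m mulrC divfK.
have nu0 : a * m + b < 0.
  rewrite -(@nmulr_rgt0 _ c)//.
  have -> : c * (a * m + b) = a * (c * m) + b * c by ring.
  by rewrite mc; lra.
(* On the nullcline x' = (a m + b) x^3 is negative; [del] keeps this sign in the whole region. *)
have [del [del0 _ delP]] : exists del, [/\ 0 < del, del <= 1 & `|a| * del < - (a * m + b)].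
  by apply: small_factor => //; rewrite oppr_gt0.
(* On the faces y = (m + del) x^3 and y = (m - del) x^3 the inward derivative is x^3 times - c del,
   up to a term of size at most C x^2, which [e] makes smaller. *)
pose C := 3 * `|(m + del) * (a * (m + del) + b)| + 3 * `|(m - del) * (a * (m - del) + b)|.
have C0 : 0 <= C by rewrite addr_ge0 ?mulr_ge0.
have cd0 : 0 < - c * del by rewrite mulr_gt0// oppr_gt0.
have [e [e0 e1 eP]] := small_factor C0 cd0.
pose P (z : R * R) := a * z.2 + b * z.1 ^+ 3; pose Q (z : R * R) := c * z.2 + d * z.1 ^+ 3.
pose U (i : bool * bool) (z : R * R) := match i with
  | (true, true) => z.1 | (true, false) => e - z.1
  | (false, true) => (m + del) * z.1 ^+ 3 - z.2
  | (false, false) => z.2 - (m - del) * z.1 ^+ 3 end.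
pose DU (i : bool * bool) (z : R * R) := match i with
  | (true, true) => P z | (true, false) => - P z
  | (false, true) => 3 * (m + del) * z.1 ^+ 2 * P z - Q z
  | (false, false) => Q z - 3 * (m - del) * z.1 ^+ 2 * P z end.
have Pneg x y : 0 < x -> 0 <= U (false, true) (x, y) -> 0 <= U (false, false) (x, y) ->
    P (x, y) < 0.
  move=> x0 /= u3 u4; rewrite /P /=; have x3 : 0 < x ^+ 3 by pos.
  pose th := y / x ^+ 3 - m.
  have yE : y = (m + th) * x ^+ 3 by rewrite /th; field; rewrite gt_eqF.
  have thd : `|th| <= del.
    rewrite ler_norml; apply/andP; split.
      rewrite -subr_ge0 -(pmulr_rge0 _ x3).
      by have -> : x ^+ 3 * (th - - del) = y - (m - del) * x ^+ 3 by rewrite yE; ring.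
    rewrite -subr_ge0 -(pmulr_rge0 _ x3).
    by have -> : x ^+ 3 * (del - th) = (m + del) * x ^+ 3 - y by rewrite yE; ring.
  have -> : a * y + b * x ^+ 3 = x ^+ 3 * (a * m + b + a * th) by rewrite yE; ring.
  rewrite pmulr_rlt0//; have := ler_wpM2l (normr_ge0 a) thd.
  by rewrite -normrM; have := ler_norm (a * th); lra.
have xpos x y : (x, y) <> (0, 0) -> (forall j, 0 <= U j (x, y)) -> 0 < x.
  move=> z0 Uz; have /= u1 := Uz (true, true).
  have /= u3 := Uz (false, true); have /= u4 := Uz (false, false).
  rewrite lt_def u1 andbT; apply/eqP => xx; apply: z0.
  by move: u3 u4; rewrite xx expr0n /= !mulr0 => u3 u4; congr pair; lra.
apply: (@no_center_first0 _ _ _ U DU).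
- move=> g gF i t; have [/= g1 g2] := gF t I.
  by case: i => [[] []] /=; [eassumption|der eassumption..]; rewrite /P /Q; ring.
- move=> i [x y] z0 Uz.
  have x0 := xpos _ _ z0 Uz.
  have /= u2 := Uz (true, false).
  have x3 : 0 < x ^+ 3 by pos.
  have P0 := Pneg _ _ x0 (Uz (false, true)) (Uz (false, false)).
  have x2e : x ^+ 2 <= e by apply: le_trans (_ : x <= _); [apply: exprS_le; lra|lra].
  have bnd q : 3 * `|q| <= C -> 3 * q * x ^+ 2 < - c * del.
    move=> qC; apply: le_lt_trans eP; apply: le_trans (_ : 3 * `|q| * e <= _).
      apply: le_trans (_ : 3 * `|q| * x ^+ 2 <= _).
        by apply: ler_wpM2r; [rewrite exprn_ge0// ltW|have := ler_norm q; lra].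
      by apply: ler_wpM2l => //; rewrite mulr_ge0.
    by apply: ler_wpM2r; [exact: ltW|].
  case: i => [[] []] /= E.
  + by rewrite E ltxx in x0.
  + by rewrite oppr_gt0.
  + have -> : 3 * (m + del) * x ^+ 2 * P (x, y) - Q (x, y)
      = x ^+ 3 * (3 * ((m + del) * (a * (m + del) + b)) * x ^+ 2 - c * del - (c * m + d)).
      by rewrite /P /Q /= (_ : y = (m + del) * x ^+ 3); [ring|lra].
    rewrite mc mulr_gt0//.
    have : 3 * (- ((m + del) * (a * (m + del) + b))) * x ^+ 2 < - c * del.
      apply: bnd; rewrite normrN /C.
      by have := normr_ge0 ((m - del) * (a * (m - del) + b)); lra.
    by lra.
  + have -> : Q (x, y) - 3 * (m - del) * x ^+ 2 * P (x, y)
      = x ^+ 3 * (c * m + d - c * del - 3 * ((m - del) * (a * (m - del) + b)) * x ^+ 2).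
      by rewrite /P /Q /= (_ : y = (m - del) * x ^+ 3); [ring|lra].
    rewrite mc mulr_gt0//.
    have : 3 * ((m - del) * (a * (m - del) + b)) * x ^+ 2 < - c * del.
      apply: bnd; rewrite /C.
      by have := normr_ge0 ((m + del) * (a * (m + del) + b)); lra.
    by lra.
- move=> [x y] Uz; apply/eqP; rewrite lt_eqF//.
  exact: (Pneg _ _ (Uz (true, true)) (ltW (Uz (false, true))) (ltW (Uz (false, false)))).
- move=> r r0; have re0 : 0 < Order.min r e by rewrite lt_min r0.
  have M0 : 0 <= 1 + `|m| by rewrite addr_ge0.
  have [x [x0 x1]] := small_factor M0 re0.
  rewrite lt_min mulrDl mul1r => /andP[xr xe].
  have mx0 : 0 <= `|m| * x by rewrite mulr_ge0// ltW.
  have dx0 : 0 < del * x ^+ 3 by pos.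
  exists (x, m * x ^+ 3); split => /=.
  + by case => xx; rewrite xx ltxx in x0.
  + by rewrite gtr0_norm//; lra.
  + rewrite normrM normrX (gtr0_norm x0).
    have x3 : x ^+ 3 <= x by apply: exprS_le => //; exact: ltW.
    by have := ler_wpM2l (normr_ge0 m) x3; lra.
  + by case=> [[] []] /=; rewrite ?mulrDl ?mulNr; lra.
Qed.

(** The sign of ad - bc decides: a y' - c x' = (ad - bc) x^3. If it is zero, a y - c x is a first
    integral, and this turns the derivative of the function below into the square of x'. If it is
    negative and c = 0, the energy of the system with b = 0 is monotone. *)
Lemma no_center_weights13 a b c d : a * d < 0 -> b != 0 \/ c != 0 ->
  ~ is_center (fun z => (a * z.2 + b * z.1 ^+ 3, c * z.2 + d * z.1 ^+ 3)) (0, 0).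
Proof.
move=> ad bc; have a0 : a != 0 by apply/eqP => a0; move: ad; rewrite a0 mul0r ltxx.
have d0 : d != 0 by apply/eqP => d0; move: ad; rewrite d0 mulr0 ltxx.
have [k0|k0|k0] := ltgtP (a * d - b * c) 0; last 1 first.
- apply: (@no_center_lyapunov _
    (fun z => c / 2 * z.1 ^+ 2 - (c * z.1 - a * z.2) * z.1 + b / 4 * z.1 ^+ 4)
    (fun z => (a * z.2 + b * z.1 ^+ 3) ^+ 2)).
  + move=> g gF t; have [/= g1 g2] := gF t I; der eassumption.
    have -> : (a * (g t).2 + b * (g t).1 ^+ 3) ^+ 2 = (a * (g t).2 + b * (g t).1 ^+ 3) ^+ 2
      + (a * d - b * c) * (g t).1 ^+ 4 by rewrite k0 mul0r addr0.
    by field.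
  + by move=> z; exact: sqr_ge0.
  + move=> e e0; have e2 : 0 < e / 2 by rewrite divr_gt0.
    exists (0, e / 2); rewrite /= normr0 gtr0_norm//; split => //.
    * by case=> /eqP; rewrite gt_eqF.
    * by lra.
    * by apply/eqP; rewrite expr0n /= mulr0 addr0 sqrf_eq0 mulf_neq0// gt_eqF.
- have [c0|c0|c0] := ltgtP c 0.
  + exact: no_center_weights13_node_aux.
  + move=> H; have c0' : - c < 0 by rewrite oppr_lt0.
    apply: (@no_center_weights13_node_aux (- a) (- b) (- c) (- d) c0'); first by rewrite !mulrNN.
    apply: center_ext (@center_signs R (-1) 1 1 _ _ _ _ H) => [-[x y] /=|||]; last 3 first.
    * by ring.
    * by ring.
    * by ring.
    by congr pair; ring.
  + have b0 : b != 0 by case: bc => //; rewrite c0 eqxx.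
    apply: (@no_center_lyapunov _
      (fun z => - b * d * (a / 2 * z.2 ^+ 2 - d / 4 * z.1 ^+ 4)) (fun z => (b * d) ^+ 2 * z.1 ^+ 6)).
    * by move=> g gF t; have [/= g1 g2] := gF t I; der eassumption; rewrite c0; field.
    * by move=> z; rewrite mulr_ge0 ?exprn_even_ge0.
    * move=> e e0; have e2 : 0 < e / 2 by rewrite divr_gt0.
      exists (e / 2, 0); rewrite /= normr0 gtr0_norm//; split => //.
      - by case=> /eqP; rewrite gt_eqF.
      - by lra.
      - by apply/eqP; rewrite !mulf_neq0 ?expf_neq0 ?mulf_neq0// gt_eqF.
- exact: no_center_weights13_saddle.
Qed.

End NoCenterFamilies.

(** * Coefficients of a bivariate polynomial *)

Section Bisum.
Context {R : realType}.
Implicit Types (p q : nat -> nat -> R) (P Q : bipoly R).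

(** The index square contains all monomials of total degree at most three; the coefficients of the
    others vanish in the polynomials at hand. *)
Definition bisum p (x y : R) : R := \sum_(i < 4) \sum_(j < 4) p i j * x ^+ i * y ^+ j.

Definition mon (i j : nat) : multinom 2 := Multinom [tuple i; j].

Definition pcoef P (i j : nat) : R := mcoeff (mon i j) P.

Lemma mnm2E (m : multinom 2) : m = mon (m 0) (m 1).
Proof.
apply/mnmP => k; case: (eqVneq k 0) => [->//|k0].
have -> : k = 1 by apply: val_inj; case: k k0 => [[|[|]]].
by [].
Qed.

Lemma mdeg2E (m : multinom 2) : mdeg m = (m 0%R + m 1%R)%N.
Proof. by rewrite mdegE big_ord_recl big_ord1; congr (_ + m _)%N; apply: val_inj. Qed.

Lemma eval2E P x y : (msize P <= 4)%N -> eval2 P x y = bisum (pcoef P) x y.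
Proof.
move=> P4; rewrite /eval2 mevalE /bisum.
rewrite (eq_big_seq (fun m : multinom 2 => \sum_(i < 4) \sum_(j < 4)
   if (m 0 == i) && (m 1 == j) then mcoeff m P * x ^+ i * y ^+ j else 0)); last first.
  move=> m /msize_mdeg_lt; rewrite mdeg2E => mP.
  have m0 : (m 0%R < 4)%N by lia.
  have m1 : (m 1%R < 4)%N by lia.
  rewrite (bigD1 (Ordinal m0))//= (bigD1 (Ordinal m1))//= !eqxx /=.
  rewrite [X in _ = _ + X]big1 ?addr0; last first.
    move=> i /eqP i0; rewrite big1// => j _; case: ifP => // /andP[/eqP mi _].
    by case: i0; apply: val_inj.
  rewrite [X in _ = _ + X]big1 ?addr0; last first.
    move=> j /eqP j0; case: ifP => // /eqP mj.
    by case: j0; apply: val_inj.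
  by rewrite big_ord_recl big_ord1 mulrA /=; congr (_ * _ ^+ m _); apply: val_inj.
rewrite exchange_big; apply: eq_bigr => i _; rewrite exchange_big; apply: eq_bigr => j _.
rewrite -big_mkcond /=; set mm := mon i j.
rewrite (eq_bigl (pred1 mm)); last first.
  move=> m /=; apply/andP/eqP => [[/eqP mi /eqP mj]|->].
    by rewrite [LHS]mnm2E mi mj.
  by rewrite !eqxx.
rewrite /pcoef -/mm; have [mP|mP] := boolP (mm \in msupp P).
  by rewrite -big_filter filter_pred1_uniq ?msupp_uniq// big_seq1.
rewrite memN_msupp_eq0// !mul0r big1_seq// => m /andP[/eqP -> mP'].
by rewrite mP' in mP.
Qed.

(** The integers 0, ..., n - 1 are already too many roots for a polynomial of size at most n. *)
Lemma poly_fun_eq0 (c : nat -> R) n : (forall x, \sum_(i < n) c i * x ^+ i = 0) ->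
  forall i, (i < n)%N -> c i = 0.
Proof.
move=> c0 i i_n; have : \poly_(i < n) c i = 0.
  apply: (@roots_geq_poly_eq0 _ _ [seq k%:R | k <- iota 0 n]).
  - by apply/allP => _ /mapP[k _ ->]; rewrite /root horner_poly c0.
  - by rewrite map_inj_uniq ?iota_uniq//; apply: (mulrIn (oner_neq0 R)).
  - by rewrite size_map size_iota size_poly.
by move/polyP/(_ i); rewrite coef_poly i_n coef0.
Qed.

Lemma bisum_eq0 p : (forall x y, bisum p x y = 0) ->
  forall i j, (i < 4)%N -> (j < 4)%N -> p i j = 0.
Proof.
move=> p0 i j i4 j4; apply: (@poly_fun_eq0 (p i) 4) j4 => y.
apply: (@poly_fun_eq0 (fun i => \sum_(j < 4) p i j * y ^+ j) 4) i4 => x.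
rewrite -[RHS](p0 x y); apply: eq_bigr => k _; rewrite mulr_suml.
by apply: eq_bigr => l _; rewrite mulrAC.
Qed.

Lemma pcoef_deg P i j : pcoef P i j != 0 -> (i + j < msize P)%N.
Proof.
rewrite /pcoef -mcoeff_msupp => /msize_mdeg_lt; by rewrite mdeg2E.
Qed.

Lemma pcoef_weight P (s1 s2 w : nat) : (msize P <= 4)%N ->
  (forall a x y : R, 0 < a -> eval2 P (a ^+ s1 * x) (a ^+ s2 * y) = a ^+ w * eval2 P x y) ->
  forall i j, pcoef P i j != 0 -> (s1 * i + s2 * j)%N = w.
Proof.
move=> P4 PE i j pij.
(* The scaling identity is used for the factor 2 only: the powers of 2 separate the weights. *)
have := @bisum_eq0 (fun i j => pcoef P i j * (2 ^+ (s1 * i + s2 * j) - 2 ^+ w)).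
move=> H; have : pcoef P i j * (2 ^+ (s1 * i + s2 * j) - 2 ^+ w) = 0.
  have ij : (i + j < 4)%N := leq_trans (pcoef_deg pij) P4.
  have i4 : (i < 4)%N by lia.
  have j4 : (j < 4)%N by lia.
  apply: H => //.
  move=> x y; have := PE 2 x y (ltr0Sn _ 1); rewrite !eval2E// => /eqP.
  rewrite -subr_eq0 => /eqP <-; rewrite /bisum mulr_sumr -sumrB; apply: eq_bigr => k _.
  rewrite mulr_sumr -sumrB; apply: eq_bigr => l _.
  by rewrite !exprMn -!exprM exprD; ring.
move/eqP; rewrite mulf_eq0 (negbTE pij) /= subr_eq0 => /eqP.
by apply: ieexprIn; rewrite ?ltr0Sn// gt_eqF// ltr1n.
Qed.

Lemma homog_pcoef P (d : nat) : (forall i j, pcoef P i j != 0 -> (i + j)%N = d) ->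
  P \is ishomog mdeg.
Proof.
move=> Pd; apply/homogP; exists d; apply/dhomogP => m mP.
apply: etrans (mdeg2E m) _; apply: Pd.
by rewrite /pcoef -mnm2E -mcoeff_msupp.
Qed.

Lemma loc_lipD (f h : R * R -> R) : loc_lip f -> loc_lip h -> loc_lip (fun z => f z + h z).
Proof.
move=> fl hl M; have [K1 K10 H1] := fl M; have [K2 K20 H2] := hl M.
exists (K1 + K2); first exact: addr_ge0.
move=> z w z1 z2 w1 w2; rewrite opprD addrACA mulrDl.
by apply: le_trans (ler_normD _ _) (lerD _ _); [exact: H1|exact: H2].
Qed.

Lemma loc_lipM (f h : R * R -> R) : loc_lip f -> loc_lip h -> loc_lip (fun z => f z * h z).
Proof.
move=> fl hl M; have [K1 K10 H1] := fl M; have [K2 K20 H2] := hl M.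
have [M0|M0] := leP 0 M; last first.
  by exists 0 => // z w z1; have := normr_ge0 z.1; lra.
(* Bounds for the two factors on the square, by comparison with their values at the origin. *)
pose B1 := `|f (0, 0)| + K1 * (2 * M); pose B2 := `|h (0, 0)| + K2 * (2 * M).
have bnd (k : R * R -> R) K : 0 <= K -> (forall z w : R * R, `|z.1| <= M -> `|z.2| <= M ->
      `|w.1| <= M -> `|w.2| <= M -> `|k z - k w| <= K * (`|z.1 - w.1| + `|z.2 - w.2|)) ->
    forall z : R * R, `|z.1| <= M -> `|z.2| <= M -> `|k z| <= `|k (0, 0)| + K * (2 * M).
  move=> K0 kP z z1 z2; have := kP z (0, 0) z1 z2; rewrite /= normr0 !subr0 => /(_ M0 M0) E.
  rewrite -[k z](subrK (k (0, 0))) addrC; apply: le_trans (ler_normD _ _) _.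
  rewrite lerD2l; apply: le_trans E _; apply: ler_wpM2l => //; lra.
exists (B1 * K2 + B2 * K1).
  by rewrite addr_ge0 ?mulr_ge0 ?addr_ge0 ?mulr_ge0.
move=> z w z1 z2 w1 w2.
have -> : f z * h z - f w * h w = f z * (h z - h w) + h w * (f z - f w) by ring.
rewrite mulrDl -!mulrA; apply: le_trans (ler_normD _ _) _; rewrite !normrM; apply: lerD.
  by apply: ler_pM => //; [exact: bnd|exact: H2].
by apply: ler_pM => //; [exact: bnd|exact: H1].
Qed.

Lemma loc_lip_cst (c : R) : loc_lip (fun _ => c).
Proof. by move=> M; exists 0 => // z w _ _ _ _; rewrite subrr normr0 mul0r. Qed.

Lemma loc_lip_fst : loc_lip (fun z : R * R => z.1).
Proof. by move=> M; exists 1 => // z w _ _ _ _; rewrite mul1r lerDl. Qed.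

Lemma loc_lip_snd : loc_lip (fun z : R * R => z.2).
Proof. by move=> M; exists 1 => // z w _ _ _ _; rewrite mul1r lerDr. Qed.

Lemma loc_lipX (f : R * R -> R) n : loc_lip f -> loc_lip (fun z => f z ^+ n).
Proof.
move=> fl; elim: n => [|n IHn]; first exact: loc_lip_cst.
by under eq_fun do rewrite exprS; exact: loc_lipM.
Qed.

Lemma loc_lip_sum n (f : nat -> R * R -> R) : (forall i, loc_lip (f i)) ->
  loc_lip (fun z => \sum_(i < n) f i z).
Proof.
move=> fl; elim: n => [|n IHn].
  by under eq_fun do rewrite big_ord0; exact: loc_lip_cst.
by under eq_fun do rewrite big_ord_recr; exact: loc_lipD.
Qed.

Lemma loc_lip_bisum p : loc_lip (fun z => bisum p z.1 z.2).
Proof.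
apply: (@loc_lip_sum 4 (fun i z => \sum_(j < 4) p i j * z.1 ^+ i * z.2 ^+ j)) => i.
apply: (@loc_lip_sum 4 (fun j z => p i j * z.1 ^+ i * z.2 ^+ j)) => j.
apply: loc_lipM; [apply: loc_lipM|]; [exact: loc_lip_cst|..]; apply: loc_lipX;
  [exact: loc_lip_fst|exact: loc_lip_snd].
Qed.

Lemma expr_near1 (n : nat) (x e : R) : 0 < e ->
  exists2 d, 0 < d & forall a, `|a - 1| < d -> `|a ^+ n * x - x| < e.
Proof.
move=> e0; have : {for 1, continuous (fun a : R => a ^+ n * x)}.
  by apply: isd_cont; der fail.
move=> /cvgrPdist_lt/(_ e e0)/nbhs_ballP[d /= d0 dP]; exists d => // a ad.
have /dP : ball (1 : R) d a by rewrite /ball /= distrC.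
by rewrite expr1n mul1r distrC.
Qed.

(** The weighted dilations of a singular point are singular. One of them, with factor [a] slightly
    above 1, is near z and distinct from it; by uniqueness the solution through it is constant,
    hence not a periodic orbit. *)
Lemma weighted_center_origin (F : R * R -> R * R) (s1 s2 w1 w2 : nat) z :
  (0 < s1)%N -> (0 < s2)%N ->
  loc_lip (fun z => (F z).1) -> loc_lip (fun z => (F z).2) ->
  (forall a x y, 0 < a -> F (a ^+ s1 * x, a ^+ s2 * y)
     = (a ^+ w1 * (F (x, y)).1, a ^+ w2 * (F (x, y)).2)) ->
  is_center F z -> z = (0, 0).
Proof.
move=> s10 s20 F1 F2 Fa zc; apply: contrapT => z0.
have Fz : F z = (0, 0) by case: zc.
have [e e0 eP] := center_near zc.
have [d1 d10 d1P] := expr_near1 s1 z.1 e0; have [d2 d20 d2P] := expr_near1 s2 z.2 e0.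
pose d := Order.min d1 d2 / 2; pose a := 1 + d.
have d0 : 0 < d by rewrite divr_gt0// lt_min d10.
have dd : `|a - 1| < Order.min d1 d2.
  rewrite /a addrAC subrr add0r gtr0_norm// /d.
  by have : 0 < Order.min d1 d2 by [rewrite lt_min d10]; lra.
have a1 : 1 < a by rewrite /a; lra.
have a0 : 0 < a by lra.
move: dd; rewrite lt_min => /andP[/d1P h1 /d2P h2].
pose w := (a ^+ s1 * z.1, a ^+ s2 * z.2).
have nz (s : nat) (x : R) : (0 < s)%N -> a ^+ s * x = x -> x = 0.
  move=> s0 /eqP; rewrite -subr_eq0 -[X in _ - X]mul1r -mulrBl mulf_eq0 subr_eq0.
  by rewrite gt_eqF ?exprn_egt1 -?lt0n//= => /eqP.
have wz : w <> z.
  move=> wz; apply: z0; rewrite [z]surjective_pairing; congr pair.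
    by apply: (nz s1) => //; rewrite -[RHS](congr1 fst wz).
  by apply: (nz s2) => //; rewrite -[RHS](congr1 snd wz).
have [g [T [gF _ _ g0 [_ [t gt]]]]] := eP w wz h1 h2.
have wF : solution_on setT F (fun _ => w).
  move=> s _; rewrite /w Fa// -surjective_pairing Fz /= !mulr0.
  by split; exact: isd_cst.
by apply: gt; rewrite (sol_uniq F1 F2 gF wF).
Qed.

End Bisum.

(** * Classification of the centers *)

Section Classification.
Context {R : realType}.
Implicit Types (p q : nat -> nat -> R) (F : R * R -> R * R) (a b c d : R).

Definition field p q (z : R * R) : R * R := (bisum p z.1 z.2, bisum q z.1 z.2).

Definition weighted (s1 s2 w : nat) p :=
  forall i j, p i j != 0 -> (i + j <= 3)%N /\ (s1 * i + s2 * j = w)%N.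

Lemma weightedN s1 s2 w p i j : weighted s1 s2 w p ->
  (3 < i + j)%N || (s1 * i + s2 * j != w)%N -> p i j = 0.
Proof.
move=> pw; apply: contraTeq => /pw[ij /eqP ->].
by rewrite orbF -leqNgt.
Qed.

Lemma bisumE s1 s2 w p x y : weighted s1 s2 w p -> bisum p x y =
  p 0 0 + p 0 1 * y + p 0 2 * y ^+ 2 + p 0 3 * y ^+ 3 + p 1 0 * x + p 1 1 * x * y
  + p 1 2 * x * y ^+ 2 + p 2 0 * x ^+ 2 + p 2 1 * x ^+ 2 * y + p 3 0 * x ^+ 3.
Proof.
move=> pw; have p0 i j : (3 < i + j)%N -> p i j = 0 by move=> ij; rewrite (weightedN pw)// ij.
rewrite /bisum !big_ord_recl !big_ord0 /=.
rewrite /bump /= ?add1n ?add0n ?addn0 ?addn1.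
rewrite (p0 1 3)// (p0 2 2)// (p0 2 3)// (p0 3 1)// (p0 3 2)// (p0 3 3)//.
by ring.
Qed.

(** On an axis the weight determines the exponent. If the restriction is zero, the answer is the
    monomial of exponent 3 with coefficient 0, which is why the weight equation is guarded by
    [b != 0]. *)
Lemma axis_monomial (h : nat -> R) (s w : nat) : (0 < s)%N -> h 0 = 0 ->
  (forall j, h j != 0 -> (s * j = w)%N) ->
  exists b k, [/\ (0 < k < 4)%N, b = h k, b != 0 -> (s * k = w)%N &
    forall y, h 0 + h 1 * y + h 2 * y ^+ 2 + h 3 * y ^+ 3 = b * y ^+ k].
Proof.
move=> s0 h0 hw; have hh i j : h i != 0 -> i != j -> h j = 0.
  move=> hi; apply: contraNeq => hj; rewrite -(eqn_pmul2l s0).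
  by rewrite (hw _ hi) (hw _ hj).
have [h1|h1] := eqVneq (h 1) 0; last first.
  by exists (h 1), 1; split => [|||y]//; [exact: hw|rewrite h0 (hh 1 2)// (hh 1 3)//; ring].
have [h2|h2] := eqVneq (h 2) 0; last first.
  by exists (h 2), 2; split => [|||y]//; [exact: hw|rewrite h0 h1 (hh 2 3)//; ring].
by exists (h 3), 3; split => [|||y]//; [exact: hw|rewrite h0 h1 h2; ring].
Qed.

(** For a = 0 the axis would be invariant; for k = 2 it would be crossed in one direction only. *)
Lemma center_axis F : loc_lip (fun z => (F z).1) -> is_center F (0, 0) ->
  forall a k b j, (0 < k < 4)%N ->
  (forall y, F (0, y) = (a * y ^+ k, b * y ^+ j)) -> a != 0 /\ (k = 1 \/ k = 3)%N.
Proof.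
move=> Flip Fc a k b j k4 FE; have a0 : a != 0.
  apply/eqP => a0; apply: (no_center_axis Flip _ Fc) => y.
  by rewrite FE a0 mul0r.
split=> //; case: k k4 FE => [|[|[|[|k]]]]// _ FE; [by left| |by right].
exfalso; case: (ltgtP a 0) a0 => // a0 _.
  have := @center_signs R (-1) 1 1 F; rewrite !mulr1 mulrNN mulr1 => /(_ erefl erefl erefl Fc).
  apply: no_center_one_way => y /eqP y0 /=.
  by rewrite mulr0 mul1r FE /= mulN1r oppr_gt0 pmulr_llt0// exprn_even_gt0.
apply: no_center_one_way Fc => y /eqP y0.
by rewrite FE /= pmulr_lgt0// exprn_even_gt0.
Qed.

Lemma center_turns F a d k l : is_center F (0, 0) -> odd k -> odd l ->
  (forall y, (F (0, y)).1 = a * y ^+ k) -> (forall x, (F (x, 0)).2 = d * x ^+ l) ->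
  a * d <= 0.
Proof.
move=> Fc ko lo F1 F2; rewrite leNgt; apply/negP => ad.
case: (ltgtP a 0) => a0; last by move: ad; rewrite a0 mul0r ltxx.
  have d0 : d < 0 by move: ad; rewrite nmulr_rgt0.
  have := @center_signs R (-1) 1 1 F; rewrite !mulr1 mulrNN mulr1 => /(_ erefl erefl erefl Fc).
  apply: no_center_quadrant => y y0 /=.
    by rewrite mulr0 mul1r F1 mulN1r oppr_gt0 pmulr_llt0// exprn_gt0.
  by rewrite mulr0 mul1r F2 mulN1r oppr_gt0 pmulr_llt0// exprn_gt0.
have d0 : 0 < d by move: ad; rewrite pmulr_rgt0.
apply: no_center_quadrant Fc => y y0 /=.
  by rewrite F1 pmulr_lgt0// exprn_gt0.
by rewrite F2 pmulr_lgt0// exprn_gt0.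
Qed.

Definition homogeneous p := exists d : nat, forall i j, p i j != 0 -> (i + j = d)%N.

(** The inequalities [s1 <= w1] and [s2 <= w2] translate the positivity of d1 and d2, and
    [w1 + s2 <> w2 + s1] translates d1 <> d2. *)
Lemma classification p q (s1 s2 w1 w2 : nat) :
  (0 < s1)%N -> (s1 < s2)%N -> weighted s1 s2 w1 p -> weighted s1 s2 w2 q ->
  (s1 <= w1)%N -> (s2 <= w2)%N -> (w1 + s2 <> w2 + s1)%N ->
  ~ (homogeneous p /\ homogeneous q) -> is_center (field p q) (0, 0) ->
  exists a c d, [/\ a * d < 0, c != 0, q 3 0 != 0 &
    forall z, field p q z = (a * z.2, c * z.2 ^+ 2 + d * z.1 ^+ 3)].
Proof.
move=> s10 s12 pw qw w10 w20 w12 nh Fc; have s20 : (0 < s2)%N by apply: leq_trans s12.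
have p00 : p 0 0 = 0 by rewrite (weightedN pw)//; apply/orP; right; lia.
have q00 : q 0 0 = 0 by rewrite (weightedN qw)//; apply/orP; right; lia.
have [a [k [k4 aE ak Pa]]] : exists b k, [/\ (0 < k < 4)%N, b = p 0 k, b != 0 -> (s2 * k = w1)%N &
    forall y, p 0 0 + p 0 1 * y + p 0 2 * y ^+ 2 + p 0 3 * y ^+ 3 = b * y ^+ k].
  by apply: axis_monomial => // j /pw[_]; rewrite muln0.
have [b [j [_ _ _ Qb]]] : exists b k, [/\ (0 < k < 4)%N, b = q 0 k, b != 0 -> (s2 * k = w2)%N &
    forall y, q 0 0 + q 0 1 * y + q 0 2 * y ^+ 2 + q 0 3 * y ^+ 3 = b * y ^+ k].
  by apply: axis_monomial => // j /qw[_]; rewrite muln0.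
have [d [l [l4 dE dl Qd]]] : exists b k, [/\ (0 < k < 4)%N, b = q k 0, b != 0 -> (s1 * k = w2)%N &
    forall y, q 0 0 + q 1 0 * y + q 2 0 * y ^+ 2 + q 3 0 * y ^+ 3 = b * y ^+ k].
  by apply: (@axis_monomial (fun i => q i 0)) => // i /qw[_]; rewrite muln0 addn0.
have [c [i [_ _ _ Pc]]] : exists b k, [/\ (0 < k < 4)%N, b = p k 0, b != 0 -> (s1 * k = w1)%N &
    forall y, p 0 0 + p 1 0 * y + p 2 0 * y ^+ 2 + p 3 0 * y ^+ 3 = b * y ^+ k].
  by apply: (@axis_monomial (fun i => p i 0)) => // i /pw[_]; rewrite muln0 addn0.
have F0y y : field p q (0, y) = (a * y ^+ k, b * y ^+ j).
  by rewrite /field /= (bisumE _ _ pw) (bisumE _ _ qw) -Pa -Qb; congr pair; ring.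
have Fx0 x : field p q (x, 0) = (c * x ^+ i, d * x ^+ l).
  by rewrite /field /= (bisumE _ _ pw) (bisumE _ _ qw) -Pc -Qd; congr pair; ring.
have [a0 k13] := @center_axis (field p q) (loc_lip_bisum p) Fc _ _ _ _ k4 F0y.
have [d0 l13] : d != 0 /\ (l = 1 \/ l = 3)%N.
  apply: (@center_axis (swap (field p q)) _ (center_swap Fc) d l c i l4).
    move=> M; have [K K0 KP] := loc_lip_bisum q M; exists K => // z w z1 z2 w1' w2'.
    by rewrite [X in _ * X]addrC; apply: KP.
  by move=> x; have := Fx0 x; rewrite /swap /field /= => -[-> ->].
(* For l = 1 the weight of q would be s1, less than s2. *)
have {l13 dl} l3 : l = 3%N by have := dl d0; case: l13 => [l1|//]; rewrite l1; lia.
have ad : a * d < 0.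
  rewrite lt_neqAle mulf_neq0 /= ?a0 ?d0 //=.
  apply: (center_turns Fc (k := k) (l := l)) => [|||x].
  - by case: k13 => ->.
  - by rewrite l3.
  - by move=> y; rewrite F0y.
  - by rewrite Fx0.
have q30 : q 3 0 != 0 by move: d0; rewrite dE l3.
have w2E : w2 = (3 * s1)%N by have [_] := qw _ _ q30; lia.
subst l; have w1E := ak a0; move: pw qw w10 w20 w12; rewrite -w1E w2E => pw qw w10 w20 w12.
have nh' : (forall i j, p i j != 0 -> (i + j = k)%N) -> ~ (forall i j, q i j != 0 -> (i + j = 3)%N).
  by move=> ph qh; apply: nh; split; [exists k|exists 3].
have q0 i' j' : (s1 * i' + s2 * j' != 3 * s1)%N -> q i' j' = 0.
  by move=> H; rewrite (weightedN qw)// H orbT.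
have p0 i' j' : (s1 * i' + s2 * j' != s2 * k)%N -> p i' j' = 0.
  by move=> H; rewrite (weightedN pw)// H orbT.
(* Besides x^3, the weight 3 s1 admits only x y, y and y^2, when s2 = 2 s1, s2 = 3 s1 and 2 s2 = 3
   s1 respectively. *)
have QE z : (field p q z).2 = d * z.1 ^+ 3 + q 1 1 * z.1 * z.2 + q 0 1 * z.2 + q 0 2 * z.2 ^+ 2.
  rewrite /field /= (bisumE _ _ qw) q00 (q0 0 3)%N ?(q0 1 0)%N ?(q0 1 2)%N ?(q0 2 0)%N ?(q0 2 1)%N; try lia.
  by rewrite -dE; ring.
(* The weight s2 is that of y; only x^2 or x^3 can share it, as s1 < s2. *)
have ph1 : k = 1%N -> (s2 != 2 * s1)%N -> (s2 != 3 * s1)%N ->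
    forall i j, p i j != 0 -> (i + j = k)%N.
  move=> k1 n2 n3 i' j' /pw[]; rewrite k1.
  by case: i' => [|[|[|[|i']]]]; case: j' => [|[|[|[|j']]]]; lia.
(* In degree at most three, y^3 is the only monomial of weight 3 s2. *)
have ph3 : k = 3%N -> forall i j, p i j != 0 -> (i + j = k)%N.
  move=> k3 i' j' /pw[]; rewrite k3.
  by case: i' => [|[|[|[|i']]]]; case: j' => [|[|[|[|j']]]]; lia.
have PE3 : k = 3%N -> forall z, (field p q z).1 = a * z.2 ^+ 3.
  move=> k3 z; rewrite /field /= (bisumE _ _ pw) p00.
  rewrite (p0 0 1)%N ?(p0 0 2)%N ?(p0 1 0)%N ?(p0 1 1)%N ?(p0 1 2)%N ?(p0 2 0)%N ?(p0 2 1)%N ?(p0 3 0)%N; try lia.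
  by rewrite aE k3; ring.
have [s2E|s2N] := eqVneq s2 (2 * s1)%N.
  (* For k = 1 both sides of [w12] would be 4 s1: the case d1 = d2. *)
  have k3 : k = 3%N by case: k13 => // k1; exfalso; apply: w12; rewrite k1; lia.
  have q01 : q 0 1 = 0 by rewrite q0//; lia.
  have q02 : q 0 2 = 0 by rewrite q0//; lia.
  have [q11|q11] := eqVneq (q 1 1) 0.
    exfalso; apply: (nh' (ph3 k3)) => i' j' qij; have [] := qw _ _ qij.
    case: i' qij => [|[|[|[|i']]]]; case: j' => [|[|[|[|j']]]]; try lia.
    by rewrite q11 eqxx.
  exfalso; apply: (no_center_weights12 ad q11); apply: center_ext Fc => z.
  by rewrite [LHS]surjective_pairing PE3// QE q01 q02; congr pair; ring.
have q11 : q 1 1 = 0 by rewrite q0//; lia.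
have [s2E|s2N'] := eqVneq s2 (3 * s1)%N.
  have q02 : q 0 2 = 0 by rewrite q0//; lia.
  have qh : q 0 1 = 0 -> forall i j, q i j != 0 -> (i + j = 3)%N.
    move=> q01 i' j' qij; have [] := qw _ _ qij.
    case: i' qij => [|[|[|[|i']]]]; case: j' => [|[|[|[|j']]]]; try lia.
    by rewrite q01 eqxx.
  exfalso; case: k13 => k13.
    have bc : p 3 0 != 0 \/ q 0 1 != 0.
      have [q01|q01] := eqVneq (q 0 1) 0; last by right.
      left; apply/eqP => p30; apply: nh' (qh q01) => i' j' pij.
      have [] := pw _ _ pij; rewrite k13.
      case: i' pij => [|[|[|[|i']]]]; case: j' => [|[|[|[|j']]]]; try lia.
      by rewrite p30 eqxx.
    apply: (no_center_weights13 ad bc); apply: center_ext Fc => z.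
    rewrite [LHS]surjective_pairing QE q11 q02; congr pair; last by ring.
    rewrite /field /= (bisumE _ _ pw) p00.
    rewrite (p0 0 2)%N ?(p0 0 3)%N ?(p0 1 0)%N ?(p0 1 1)%N ?(p0 1 2)%N ?(p0 2 0)%N ?(p0 2 1)%N; try lia.
    by rewrite aE k13; ring.
  have [q01|q01] := eqVneq (q 0 1) 0.
    by apply: (nh' (ph3 k13)) => // ; exact: qh.
  apply: (no_center_weights13_cubic a0 q01 (d := d)); apply: center_ext Fc => z.
  by rewrite [LHS]surjective_pairing PE3// QE q11 q02; congr pair; ring.
have q01 : q 0 1 = 0 by rewrite q0//; lia.
have qh02 : q 0 2 = 0 -> forall i j, q i j != 0 -> (i + j = 3)%N.
  move=> q02 i' j' qij; have [] := qw _ _ qij.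
  case: i' qij => [|[|[|[|i']]]]; case: j' => [|[|[|[|j']]]]; try lia.
  by rewrite q02 eqxx.
have ph : forall i j, p i j != 0 -> (i + j = k)%N.
  by case: k13 => k13; [exact: ph1|exact: ph3].
have q02 : q 0 2 != 0 by apply/eqP => /qh02; exact: nh'.
case: k13 => k13; last first.
  exfalso; apply: (no_center_weights23 ad q02); apply: center_ext Fc => z.
  by rewrite [LHS]surjective_pairing PE3// QE q11 q01; congr pair; ring.
exists a, (q 0 2), d; split => // z.
rewrite [LHS]surjective_pairing QE q11 q01; congr pair; last by ring.
rewrite /field /= (bisumE _ _ pw) p00.
rewrite (p0 0 2)%N ?(p0 0 3)%N ?(p0 1 0)%N ?(p0 1 1)%N ?(p0 1 2)%N ?(p0 2 0)%N ?(p0 2 1)%N ?(p0 3 0)%N; try lia.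
by rewrite aE k13; ring.
Qed.

End Classification.

(** * Normal form, and passage from polynomials to coefficient tables *)

Section Assemble.
Context {R : realType}.
Implicit Types (F : R * R -> R * R) (a b c d : R) (P Q : bipoly R).

Definition mx2 a b c d : 'M[R]_2 :=
  \matrix_(i, j) if i == 0 then (if j == 0 then a else b) else (if j == 0 then c else d).

Lemma linear_act_mx2 a b c d : linear_act (mx2 a b c d) = lin a b c d.
Proof. by apply/funext => z; rewrite /linear_act !mxE. Qed.

Lemma mx2_mul a b c d a' b' c' d' : mx2 a b c d *m mx2 a' b' c' d' =
  mx2 (a * a' + b * c') (a * b' + b * d') (c * a' + d * c') (c * b' + d * d').
Proof.
apply/matrixP => i j; rewrite !mxE !big_ord_recl big_ord0 addr0 !mxE /=.
by case: (i == 0); case: (j == 0).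
Qed.

Lemma mx2_1 : mx2 1 0 0 1 = 1%:M.
Proof.
apply/matrixP => i j; rewrite !mxE.
by case: i => [[|[|]]]//= ?; case: j => [[|[|]]]//= ?.
Qed.

Lemma mx2E (L : 'M[R]_2) : L = mx2 (L 0 0) (L 0 1) (L 1 0) (L 1 1).
Proof.
apply/matrixP => i j; rewrite !mxE; case: (eqVneq i 0) => [->|i0].
  case: (eqVneq j 0) => [->//|j0]; congr (L _ _); apply: val_inj.
  by case: j j0 => [[|[|]]].
have -> : i = 1 by apply: val_inj; case: i i0 => [[|[|]]].
case: (eqVneq j 0) => [->//|j0]; congr (L _ _); apply: val_inj.
by case: j j0 => [[|[|]]].
Qed.

Lemma linZ a b c d k z :
  lin a b c d (k * z.1, k * z.2) = (k * (lin a b c d z).1, k * (lin a b c d z).2).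
Proof. by rewrite /lin /=; congr pair; ring. Qed.

Lemma center_can_be_written_as F G : can_be_written_as F G ->
  is_center G (0, 0) -> is_center F (0, 0).
Proof.
move=> [L [k [Lu k0 LF]]] Gc.
pose M := invmx L.
have LM : L *m M = 1%:M by rewrite mulmxV.
have ML : M *m L = 1%:M by rewrite mulVmx.
have mulK (A B : 'M[R]_2) : A *m B = 1%:M -> cancel (linear_act B) (linear_act A).
  move=> AB z; have : linear_act (A *m B) z = z.
    by rewrite AB -mx2_1 linear_act_mx2 /lin; case: z => x y /=; congr pair; ring.
  rewrite (mx2E A) (mx2E B) mx2_mul !linear_act_mx2 => E; rewrite -[RHS]E /lin /=.
  by congr pair; ring.
have cLM := mulK _ _ LM; have cML := mulK _ _ ML.
rewrite (mx2E L) (mx2E M) !linear_act_mx2 in cLM cML.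
have -> : (0, 0) = lin (M 0 0) (M 0 1) (M 1 0) (M 1 1) (0, 0) :> R * R.
  by rewrite /lin /=; congr pair; ring.
apply: (center_conj cLM cML (k := k^-1)) Gc; first by rewrite invr_eq0.
move=> w; have := LF (lin (M 0 0) (M 0 1) (M 1 0) (M 1 1) w).
rewrite (mx2E L) linear_act_mx2 cLM => E.
apply: (can_inj cML); rewrite cLM linZ E /= !mulKf//.
by rewrite -surjective_pairing.
Qed.

Lemma bisum_swap (p : nat -> nat -> R) x y : bisum (fun i j => p j i) y x = bisum p x y.
Proof.
rewrite /bisum exchange_big; apply: eq_bigr => i _; apply: eq_bigr => j _; exact: mulrAC.
Qed.

Lemma mx2_unit a b c d a' b' c' d' :
  mx2 a b c d *m mx2 a' b' c' d' = 1%:M -> mx2 a b c d \in unitmx.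
Proof. by case/mulmx1_unit. Qed.

Lemma star_form F a c d : a * d < 0 -> c != 0 ->
  (forall z, F z = (c * z.1 ^+ 2 + d * z.2 ^+ 3, a * z.1)) -> can_be_written_as F star.
Proof.
move=> ad c0 FE; have a0 : a != 0 by apply/eqP => a0; move: ad; rewrite a0 mul0r ltxx.
(* The required square - d be^3 / c equals - a d (a / c^2)^2, positive because a d < 0. *)
pose s := Num.sqrt (- (a * d)); have s0 : 0 < s by rewrite sqrtr_gt0 oppr_gt0.
have s2 : s ^+ 2 = - (a * d) by rewrite sqr_sqrtr// oppr_ge0 ltW.
(* [x = al u], [y = be v], [T = (c al) t] with [be = a / c] and [al ^ 2 = - d be ^ 3 / c] *)
pose al := s * a / c ^+ 2; pose be := a / c.
have al0 : al != 0 by rewrite !mulf_neq0 ?invr_neq0 ?expf_neq0 ?(gt_eqF s0).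
have be0 : be != 0 by rewrite mulf_neq0 ?invr_neq0.
have cbe : c * be = a by rewrite /be; field.
have al2 : d * be ^+ 3 = - c * al ^+ 2.
  rewrite /al /be !expr_div_n exprMn s2; field; exact: c0.
exists (mx2 al^-1 0 0 be^-1), (c * al); split.
- apply: (@mx2_unit _ _ _ _ al 0 0 be); rewrite mx2_mul -mx2_1; congr mx2.
  + by rewrite mulVf// mulr0 addr0.
  + by ring.
  + by ring.
  + by rewrite mulVf// mulr0 add0r.
- by rewrite mulf_neq0.
- move=> z; rewrite linear_act_mx2 FE /lin /star /=; congr pair; last first.
    by rewrite -cbe; field; rewrite al0 be0.
  have -> : d = - c * al ^+ 2 / be ^+ 3 by rewrite -al2 mulfK// expf_neq0.
  by field; rewrite al0 be0.
Qed.

Lemma can_be_written_swap F G : can_be_written_as (swap F) G -> can_be_written_as F G.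
Proof.
move=> [L [k [Lu k0 LF]]]; exists (L *m mx2 0 1 1 0), k; split => //.
  rewrite unitmx_mul Lu /=; apply: (@mx2_unit _ _ _ _ 0 1 1 0).
  by rewrite mx2_mul -mx2_1; congr mx2; ring.
move=> z; have := LF (z.2, z.1); rewrite (mx2E L) mx2_mul !linear_act_mx2 /swap /= -surjective_pairing.
have E (w : R * R) : lin (L 0 0 * 0 + L 0 1 * 1) (L 0 0 * 1 + L 0 1 * 0)
    (L 1 0 * 0 + L 1 1 * 1) (L 1 0 * 1 + L 1 1 * 0) w
  = lin (L 0 0) (L 0 1) (L 1 0) (L 1 1) (w.2, w.1).
  by rewrite /lin /=; congr pair; ring.
by rewrite !E.
Qed.

Lemma polysysE P Q : (msize P <= 4)%N -> (msize Q <= 4)%N ->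
  polysys P Q = field (pcoef P) (pcoef Q).
Proof. by move=> P4 Q4; apply/funext => z; rewrite /polysys !eval2E. Qed.

(** The bound on the sizes comes from the surviving pure cube (x^3, or y^3 after the exchange of
    coordinates); it excludes degree two. *)
Lemma center_star_form P Q z : (msize P <= 4)%N -> (msize Q <= 4)%N ->
  semi_quasi_homogeneous P Q -> ~ semihomogeneous P Q -> is_center (polysys P Q) z ->
  can_be_written_as (polysys P Q) star /\ (3 < maxn (msize P) (msize Q))%N.
Proof.
move=> P4 Q4 [s1 [s2 [d1 [d2 [[s10 s20 d10 d20] d12 sqh]]]]] nh zc.
have Pw := pcoef_weight P4 (fun a x y ha => (sqh a x y ha).1).
have Qw := pcoef_weight Q4 (fun a x y ha => (sqh a x y ha).2).
have E := polysysE P4 Q4.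
have wP : weighted s1 s2 (s1 - 1 + d1) (pcoef P).
  by move=> i j pij; split; [have := leq_trans (pcoef_deg pij) P4|exact: Pw].
have wQ : weighted s1 s2 (s2 - 1 + d2) (pcoef Q).
  by move=> i j pij; split; [have := leq_trans (pcoef_deg pij) Q4|exact: Qw].
have {}nh : ~ (homogeneous (pcoef P) /\ homogeneous (pcoef Q)).
  by move=> [[d Pd] [e Qe]]; apply: nh; split; [exact: homog_pcoef Pd|exact: homog_pcoef Qe].
have z0 : z = (0, 0).
  apply: (@weighted_center_origin _ (polysys P Q) s1 s2 (s1 - 1 + d1) (s2 - 1 + d2)) zc => //.
  - by rewrite E; exact: loc_lip_bisum.
  - by rewrite E; exact: loc_lip_bisum.
  - by move=> a x y ha; have [H1 H2] := sqh a x y ha; rewrite /polysys /= H1 H2.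
move: zc; rewrite z0 E => zc.
have [s12|s21|s12] := ltngtP s1 s2.
- have [|||a [c [d [ad c0 q30 FE]]]] := classification s10 s12 wP wQ _ _ _ nh zc; try lia.
  split; last by have := pcoef_deg q30; rewrite leq_max => ->; rewrite orbT.
  apply: can_be_written_swap; apply: (star_form ad c0) => w.
  by rewrite /swap FE.
- pose p := fun i j => pcoef Q j i; pose q := fun i j => pcoef P j i.
  have sw : swap (field (pcoef P) (pcoef Q)) = field p q.
    by apply/funext => w; congr pair; exact: esym (bisum_swap _ _ _).
  have wp : weighted s2 s1 (s2 - 1 + d2) p.
    by move=> i j /wQ[? ?]; rewrite addnC [X in _ /\ X = _]addnC.
  have wq : weighted s2 s1 (s1 - 1 + d1) q.
    by move=> i j /wP[? ?]; rewrite addnC [X in _ /\ X = _]addnC.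
  have nh' : ~ (homogeneous p /\ homogeneous q).
    move=> [[d pd] [e qe]]; apply: nh; split; [exists e|exists d] => i j pij.
      by rewrite addnC; exact: qe.
    by rewrite addnC; exact: pd.
  have := center_swap zc; rewrite sw => zc'.
  have [|||a [c [d [ad c0 q30 FE]]]] := classification s20 s21 wp wq _ _ _ nh' zc'; try lia.
  split; last by have := pcoef_deg q30; rewrite leq_max => ->.
  apply: (star_form ad c0) => -[x y].
  by have := FE (y, x); rewrite -sw /swap /field /= => -[-> ->].
(* Equal weights s give s (i + j) = w: both polynomials are homogeneous, of degree w / s. *)
- exfalso; apply: nh; split.
    exists ((s1 - 1 + d1) %/ s1)%N => i j /Pw <-.
    by rewrite -s12 -mulnDr mulKn.
  exists ((s2 - 1 + d2) %/ s1)%N => i j /Qw <-.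
  by rewrite -s12 -mulnDr mulKn.
Qed.

End Assemble.

(** * The level curves of the first integral are periodic orbits *)

Section Primitive.
Context {R : realType}.
Implicit Types (m f : R -> R).

Lemma primitive_right m (a : R) : continuous m ->
  exists F : R -> R, forall x : R, a < x -> is_derive x 1 F (m x).
Proof.
move=> mc; exists (fun x => \int[lebesgue_measure]_(t in `[a, x]) m t)%R => x ax.
have [] // := @continuous_FTC1_closed R m a x (x + 1) _ _ ax (mc x).
- by lra.
- apply: continuous_compact_integrable; first exact: segment_compact.
  exact: continuous_subspaceT.
- by move=> Fd <-; rewrite derive1E; exact: derivableP.
Qed.

(** A primitive on the right of -1 and, by the reflection of x, one on the left of 1 differ by a
    constant on the overlap; they are glued after normalization at 0. *)
Lemma primitive m : continuous m -> exists F : R -> R, forall x : R, is_derive x 1 F (m x).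
Proof.
move=> mc; have [P1 P1d] := primitive_right (-1) mc.
have mNc : continuous (fun x => m (- x)).
  by move=> x; apply: continuous_comp; [exact: opp_continuous|exact: mc].
have [G Gd] := primitive_right (-1) mNc.
pose P2 x := - G (- x).
have P2d (x : R) : x < 1 -> is_derive x 1 P2 (m x).
  move=> x1; have x1' : -1 < - x by lra.
  have := isd_comp (isdN (isd_id x)) (Gd _ x1'); rewrite opprK => /isdN H.
  by apply: isd_eq H _; ring.
pose F x := if 0 <= x then P1 x - P1 0 else P2 x - P2 0.
have FE x : -1 < x -> F x = P1 x - P1 0.
  move=> x1; rewrite /F; case: leP => // x0.
  have [|c _] := @mvt R (fun x => P1 x - P2 x) (fun=> 0) x 0 x0.
    move=> t /andP[t1 t2].
    have t3 : -1 < t by lra.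
    have t4 : t < 1 by lra.
    have {}P1d := P1d _ t3; have {}P2d := P2d _ t4.
    by der eassumption; rewrite subrr.
  by rewrite mul0r; lra.
exists F => x; have [x0|x0] := ltP (-1) x.
  apply: (@near_eq_is_derive _ _ _ (fun x => P1 x - P1 0)).
    by near=> t; rewrite FE//; near: t; exact: lt_nbhsr.
  by have {}P1d := P1d _ x0; der eassumption; ring.
apply: (@near_eq_is_derive _ _ _ (fun x => P2 x - P2 0)).
  near=> t; rewrite /F leNgt; suff -> : t < 0 by [].
  by near: t; apply: lt_nbhsl; lra.
have x1 : x < 1 by lra.
by have {}P2d := P2d _ x1; der eassumption; ring.
Unshelve. all: by end_near. Qed.

End Primitive.

(** * The first integral on the y-axis *)

Section StarProfile.
Context {R : realType}.
Implicit Types (x y : R).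

Definition profile y : R := (y ^+ 3 + 3 / 2 * y ^+ 2 + 3 / 2 * y + 3 / 4) * expR (- 2 * y).

Lemma starHE (z : R * R) : starH z = profile z.2 - (z.1 * expR (- z.2)) ^+ 2.
Proof.
rewrite /starH /profile exprMn -expRM_natl.
have -> : - 2 * z.2 = 2%:R * (- z.2) by ring.
by ring.
Qed.

(** Everything but the cube cancels: 0 is the only critical point, a maximum with contact of order
    four. *)
Lemma isd_profile y : is_derive y 1 profile (- 2 * y ^+ 3 * expR (- 2 * y)).
Proof. by rewrite /profile; der fail; field. Qed.

Lemma profile0 : profile 0 = 3 / 4.
Proof. by rewrite /profile !expr0n /= !mulr0 expR0; ring. Qed.

Lemma profile_lt y : y != 0 -> profile y < 3 / 4.
Proof.
move=> y0; rewrite -profile0; have [yn|yp] := ltP y 0.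
  have [c /andP[c1 c2] E] := mvt yn (fun t _ => isd_profile t).
  rewrite -subr_gt0 E mulr_gt0//; last by lra.
  by rewrite mulr_gt0 ?expR_gt0// mulNr -mulrN mulr_gt0// oppr_gt0 exprn_odd_lt0.
have {}yp : 0 < y by rewrite lt_def y0.
have [c /andP[c1 c2] E] := mvt yp (fun t _ => isd_profile t).
rewrite -subr_lt0 E nmulr_rlt0; first by lra.
by rewrite pmulr_llt0 ?expR_gt0// mulNr oppr_lt0 mulr_gt0// exprn_gt0.
Qed.

Lemma profile_small h : 0 < h -> exists2 y, 0 < y & profile y < h.
Proof.
(* For y >= 1 the cubic factor is at most 19/4 y^3, whereas h e^(2y) >= h (y/2)^4 > 100/16 y^3 as
   soon as h y > 100. *)
move=> h0; exists (1 + 100 / h); first by rewrite addr_gt0// divr_gt0.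
set y := 1 + _; have hy : 100 / h < y by rewrite /y; lra.
have y1 : 1 <= y by have hp : 0 < 100 / h; [rewrite divr_gt0|rewrite /y; lra].
have y0 : 0 < y by lra.
rewrite /profile mulNr expRN ltr_pdivrMr ?expR_gt0//.
have yy : 2 * y = 4%:R * (y / 2) by field.
have e4 : (y / 2) ^+ 4 <= expR (2 * y).
  rewrite yy expRM_natl; apply: lerXn2r; rewrite ?nnegrE ?expR_ge0//; first by rewrite divr_ge0// ltW.
  by have := expR_ge1Dx (y / 2); lra.
have hyy : 100 < h * y by rewrite mulrC -ltr_pdivrMr.
have y2 : y <= y ^+ 2 by rewrite expr2; have := ler_wpM2l (ltW y0) y1; lra.
have y3 : y ^+ 2 <= y ^+ 3 by rewrite exprS; have := ler_wpM2r (sqr_ge0 y) y1; lra.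
have y3p : 0 < y ^+ 3 by rewrite exprn_gt0.
have h4 : h * (y / 2) ^+ 4 <= h * expR (2 * y) by apply: ler_wpM2l => //; exact: ltW.
have E : h * (y / 2) ^+ 4 = (h * y) * y ^+ 3 / 16 by field.
have hy3 : 100 * y ^+ 3 < (h * y) * y ^+ 3 by rewrite ltr_pM2r.
by lra.
Qed.

End StarProfile.

(** * The signed fourth root and its inverse *)

Section StarRoot.
Context {R : realType}.
Implicit Types (x y : R).

Definition root4 x : R := Num.sqrt (Num.sqrt x).

Lemma root4K x : 0 <= x -> root4 x ^+ 4 = x.
Proof. by move=> x0; rewrite /root4 (exprM _ 2 2) !sqr_sqrtr// sqrtr_ge0. Qed.

Lemma root4_continuous : continuous root4.
Proof.
move=> x; apply: (@continuous_comp _ _ _ Num.sqrt Num.sqrt); exact: sqrt_continuous.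
Qed.

Lemma root4_gt0 x : 0 < x -> 0 < root4 x.
Proof. by move=> x0; rewrite !sqrtr_gt0. Qed.

Lemma isd_root4 (t : R) (f : R -> R) (df : R) : is_derive t 1 f df -> 0 < f t ->
  is_derive t 1 (fun s => root4 (f s)) (df / (4 * root4 (f t) ^+ 3)).
Proof.
move=> fd ft; have sft : 0 < Num.sqrt (f t) by rewrite sqrtr_gt0.
have := isd_comp fd (is_derive1_sqrt ft) => H.
have := isd_comp H (is_derive1_sqrt sft) => {}H.
apply: isd_eq H _.
have r0 : root4 (f t) != 0 by rewrite gt_eqF// root4_gt0.
have E : Num.sqrt (f t) = root4 (f t) ^+ 2 by rewrite /root4 sqr_sqrtr// ltW.
by rewrite -/(root4 (f t)) E; field.
Qed.

Lemma expr4_inj : {in Num.nneg &, injective (fun x : R => x ^+ 4)}.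
Proof. exact: pexpIrn. Qed.

(* Away from [0], [starS y] is the signed fourth root of [3 / 4 - profile y]; the value
   of [starQ] at [0] is the limit that makes [starS] differentiable with [starS' 0 <> 0]. *)
Definition starQ y : R := if y == 0 then 1 / 2 else (3 / 4 - profile y) / y ^+ 4.

Definition starK y : R := root4 (starQ y).

Definition starS y : R := y * starK y.

Lemma starK_gt0 y : 0 < starK y.
Proof.
apply: root4_gt0; rewrite /starQ; case: eqVneq => [_|y0]; first by lra.
by rewrite divr_gt0 ?exprn_even_gt0// subr_gt0 profile_lt.
Qed.

Lemma starS4 y : starS y ^+ 4 = 3 / 4 - profile y.
Proof.
have := starK_gt0 y; rewrite /starS /starK /starQ exprMn.
case: eqVneq => [->|y0] _; first by rewrite expr0n mul0r profile0 subrr.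
have y4 : y ^+ 4 != 0 by rewrite expf_neq0.
rewrite root4K; last by rewrite divr_ge0 ?exprn_even_ge0// subr_ge0 ltW// profile_lt.
by rewrite mulrC divfK.
Qed.

Lemma starQ_continuous : continuous starQ.
Proof.
have dK y : is_derive y 1 (fun y : R => 3 / 4 - profile y) (2 * y ^+ 3 * expR (- 2 * y)).
  by have H := isd_profile y; der eassumption; ring.
move=> y; have [->|y0] := eqVneq y 0.
  rewrite /continuous_at {2}/starQ eqxx.
  have H : (3 / 4 - profile x) / x ^+ 4 @[x --> (0 : R)^'] --> (1 / 2 : R).
    (* The values 2 and 4 of the two derivatives at 0 are artificial: they make the quotient equal
       to e^(-2x) / 2 at 0 too. *)
    apply: (@lhopital R _ (fun x => if x == 0 then 2 else 2 * x ^+ 3 * expR (- 2 * x))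
       _ (fun x => if x == 0 then 4 else 4 * x ^+ 3) (-1) 1 0).
    - by rewrite in_itv /= ltrN10 ltr01.
    - move=> x; rewrite inE /= => -[_ /eqP/negbTE ->]; exact: dK.
    - move=> x; rewrite inE /= => -[_ /eqP/negbTE ->].
      by der fail; ring.
    - have := isd_cont (dK 0); rewrite /prop_for /continuous_at profile0 subrr; exact.
    - have : {for (0 : R), continuous (fun x : R => x ^+ 4)} by apply: isd_cont; der fail.
      by rewrite /prop_for /continuous_at expr0n; exact.
    - move=> x; rewrite inE /= => -[_ /eqP x0]; rewrite (negbTE x0).
      by rewrite mulf_neq0 ?expf_neq0.
    - rewrite (_ : (fun x : R => _ / _) = (fun x => 1 / 2 * expR (- 2 * x))); last first.
        apply/funext => x; case: eqVneq => [->|x0]; first by rewrite mulr0 expR0; field.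
        by field.
      have : {for (0 : R), continuous (fun x : R => 1 / 2 * expR (- 2 * x))}.
        by apply: isd_cont; der fail.
      by rewrite /prop_for /continuous_at mulr0 expR0 mulr1; exact.
  apply/cvgrPdist_lt => e e0.
  have /cvgrPdist_lt/(_ e e0) := H => /nbhs_ballP[d /= d0 dP].
  apply/nbhs_ballP; exists d => // x xd /=; rewrite /starQ; case: (eqVneq x 0) => [_|x0].
    by rewrite subrr normr0.
  exact: dP.
have : {for y, continuous (fun y => (3 / 4 - profile y) / y ^+ 4)}.
  apply: cvgM; first exact: isd_cont (dK y).
  apply: cvgV; first by rewrite expf_neq0.
  by apply: (@isd_cont _ y (fun x => x ^+ 4)); der fail.
rewrite /prop_for /continuous_at {2}/starQ (negbTE y0).
apply: cvg_trans; apply: near_eq_cvg; near=> x; rewrite /starQ ifN//.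
by near: x; apply: (cvgr_neq0 _ _ y0); exact: cvg_id.
Unshelve. all: by end_near. Qed.

Lemma starK_continuous : continuous starK.
Proof.
move=> y; apply: (@continuous_comp _ _ _ starQ root4).
  exact: starQ_continuous.
exact: root4_continuous.
Qed.

(** Off 0, differentiate S^4 = 3/4 - phi; the factor y^3 cancels. At 0 the difference quotient is
    [starK], and [starK 0 ^+ 4 = 1 / 2] makes both formulas agree. *)
Lemma isd_starS y : is_derive y 1 starS (expR (- 2 * y) / (2 * starK y ^+ 3)).
Proof.
have K0 := starK_gt0 y; have Kn0 : starK y != 0 by rewrite gt_eqF.
have NE t : t != 0 -> root4 (3 / 4 - profile t) = `|starS t|.
  move=> t0; apply: expr4_inj; rewrite ?nnegrE ?sqrtr_ge0//.
  rewrite root4K; last by rewrite subr_ge0 ltW// profile_lt.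
  by rewrite -normrX ger0_norm ?exprn_even_ge0// starS4.
have SE t : `|starS t| = `|t| * starK t by rewrite normrM (gtr0_norm (starK_gt0 t)).
have dN (z : R) : z != 0 -> is_derive z 1 (fun t => root4 (3 / 4 - profile t))
    (2 * z ^+ 3 * expR (- 2 * z) / (4 * (`|z| * starK z) ^+ 3)).
  move=> z0; have H := isd_profile z; rewrite -SE -NE//.
  apply: isd_root4; last by rewrite subr_gt0 profile_lt.
  by der eassumption; ring.
have [yn|yp|y0] := ltgtP y 0.
- apply: (@near_eq_is_derive _ _ _ (fun t => - root4 (3 / 4 - profile t))).
    near=> t; have tn : t < 0 by near: t; exact: lt_nbhsl.
    by rewrite NE ?lt_eqF// SE ltr0_norm// mulNr opprK.
  have yn0 : y != 0 by rewrite lt_eqF.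
  have H := dN _ yn0; rewrite (ltr0_norm yn) in H.
  by der eassumption; field; rewrite yn0 Kn0.
- apply: (@near_eq_is_derive _ _ _ (fun t => root4 (3 / 4 - profile t))).
    near=> t; have tp : 0 < t by near: t; exact: lt_nbhsr.
    by rewrite NE ?gt_eqF// SE gtr0_norm.
  have yn0 : y != 0 by rewrite gt_eqF.
  have H := dN _ yn0; rewrite (gtr0_norm yp) in H.
  by apply: isd_eq H _; field; rewrite yn0 Kn0.
have -> : expR (- 2 * y) / (2 * starK y ^+ 3) = starK 0.
  rewrite y0 mulr0 expR0; have E : starK 0 ^+ 4 = 1 / 2.
    by rewrite /starK /starQ eqxx root4K//; lra.
  have k0 : 2 * starK 0 ^+ 3 != 0 by rewrite mulf_neq0// expf_neq0// gt_eqF// starK_gt0.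
  have {1}-> : 1 = starK 0 * (2 * starK 0 ^+ 3) by rewrite mulrCA -exprS E; field.
  by rewrite mulfK.
have : (fun h : R => h^-1 *: ((starS \o shift 0) (h *: (1 : R)) - starS 0)) @ 0^' --> starK 0.
  apply/cvgrPdist_lt => e e0.
  have Kc : starK @ (0 : R) --> starK 0 by exact: starK_continuous.
  have /cvgrPdist_lt/(_ e e0)/nbhs_ballP[d /= d0 dP] := Kc.
  apply/nbhs_ballP; exists d => // h hd h0 /=.
  rewrite addr0 /GRing.scale /= mulr1 /starS mul0r subr0 mulKf//.
  exact: dP.
rewrite y0 => H; apply: DeriveDef; first by apply/cvg_ex; exists (starK 0).
by apply: cvg_lim.
Unshelve. all: by end_near. Qed.

Lemma starS_gt0 y : 0 < y -> 0 < starS y.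
Proof. by move=> y0; rewrite mulr_gt0// starK_gt0. Qed.

Lemma starS_lt0 y : y < 0 -> starS y < 0.
Proof. by move=> y0; rewrite nmulr_rlt0// starK_gt0. Qed.

Lemma starS_inj : injective starS.
Proof.
have lt x y : x < y -> starS x != starS y.
  move=> xy; have [c _ E] := mvt xy (fun t _ => isd_starS t).
  rewrite eq_sym -subr_eq0 E mulf_neq0 ?subr_eq0 ?gt_eqF// divr_gt0 ?expR_gt0//.
  by rewrite mulr_gt0// exprn_gt0// starK_gt0.
move=> x y /eqP E; apply: contraTeq E => /=; case: ltgtP => // xy _.
  exact: lt.
by rewrite eq_sym lt.
Qed.

(** The inverse of [starS], with value 0 off its range; the range is bounded above, since S^4 < 3/4
    for y > 0. *)
Definition starPsi (s : R) : R := xget 0 [set y | starS y = s].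

Lemma starSK : cancel starS starPsi.
Proof.
move=> y; rewrite /starPsi; case: xgetP => [z _ /starS_inj//|/(_ y)/= H].
by case: H.
Qed.

Lemma isd_starPsi y :
  is_derive (starS y) 1 starPsi (2 * starK y ^+ 3 * expR (2 * y)).
Proof.
have K0 := starK_gt0 y; have Kn0 : starK y != 0 by rewrite gt_eqF.
apply: isd_eq (@is_derive_inverse _ starS starPsi _ _ _ _ (isd_starS y) _) _.
- by near=> t; exact: starSK.
- by near=> t; exact: isd_cont (isd_starS t).
- by rewrite mulf_neq0 ?invr_neq0 ?mulf_neq0 ?expf_neq0 ?gt_eqF ?expR_gt0.
- by rewrite mulNr expRN; field; rewrite Kn0 gt_eqF ?expR_gt0.
Unshelve. all: by end_near. Qed.

(** Intermediate values: [starS] exceeds l far on the right, where the profile is small, and is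
    below - l at -1, where the profile is negative. *)
Lemma starPsiK (l s : R) : 0 < l -> l ^+ 4 < 3 / 4 -> `|s| <= l -> starS (starPsi s) = s.
Proof.
move=> l0 l4 sl; suff [y <-] : exists y, starS y = s by rewrite starSK.
have h0 : 0 < 3 / 4 - l ^+ 4 by rewrite subr_gt0.
have [b b0 bh] := profile_small h0.
have Sb : l <= starS b.
  have := starS_gt0 b0 => Sb0; rewrite -(ler_pXn2r (n := 4))// ?nnegrE ?ltW//.
  by rewrite starS4; lra.
have Sa : starS (-1) <= - l.
  have /starS_lt0 Sa0 : (-1 : R) < 0 by rewrite ltrN10.
  rewrite lerNr -(ler_pXn2r (n := 4))// ?nnegrE ?oppr_ge0 ?(ltW l0) ?(ltW Sa0)//.
  rewrite exprNn starS4 /profile.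
  have e0 : 0 < expR (- 2 * -1) :> R := expR_gt0 _.
  lra.
move: sl; rewrite ler_norml => /andP[s1 s2].
have ab : (-1 : R) <= b by lra.
have [||c _ <-] := @IVT R starS (-1) b s ab.
- by apply: continuous_subspaceT => x; exact: isd_cont (isd_starS x).
- by rewrite ge_min le_max; apply/andP; split; apply/orP; [left|right]; lra.
by exists c.
Qed.

End StarRoot.

Section LevelCurves.
Context {R : realType}.
Implicit Types (x y : R) (m tau : R -> R).

(** A primitive [tau] of [m] is time as a function of the parameter. It is a bijection, gains the
    constant [T] over each period [p], and its inverse is the required [th]. *)
Lemma periodic_reparametrization (m : R -> R) (p : R) : 0 < p -> continuous m ->
  (forall t, 0 < m t) -> (forall t, m (t + p) = m t) ->
  exists (th : R -> R) (T : R), [/\ 0 < T, forall t, th (t + T) = th t + p,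
    forall t : R, is_derive t 1 th (m (th t))^-1 & forall s, exists t, th t = s].
Proof.
move=> p0 mc m0 mp; have [tau taud] := primitive mc.
pose T := tau p - tau 0.
have T0 : 0 < T.
  have [c _ E] := mvt p0 (fun t _ => taud t).
  by rewrite /T E mulr_gt0 ?subr0.
have tauT t : tau (t + p) = tau t + T.
  have E : tau (t + p) - tau t = T.
    have := @isd0_cst R (fun t => tau (t + p) - tau t) _ t; rewrite add0r; apply => s.
    have H1 := isd_comp (isdD (isd_id s) (isd_cst s p)) (taud (s + p)).
    by have H2 := taud s; der eassumption; rewrite mp; ring.
  by rewrite -E; ring.
have tau_inj : injective tau.
  have lt x y : x < y -> tau x != tau y.
    move=> xy; have [c _ E] := mvt xy (fun t _ => taud t).
    by rewrite eq_sym -subr_eq0 E mulf_neq0 ?subr_eq0 ?gt_eqF.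
  move=> x y /eqP E; apply: contraTeq E => /=; case: ltgtP => // xy _.
    exact: lt.
  by rewrite eq_sym lt.
have taun n : tau (p *+ n) = tau 0 + T *+ n.
  elim: n => [|n IHn]; first by rewrite !mulr0n addr0.
  by rewrite !mulrSr tauT IHn -addrA.
have tauNn n : tau (- (p *+ n)) = tau 0 - T *+ n.
  elim: n => [|n IHn]; first by rewrite !mulr0n oppr0 addr0.
  have := tauT (- (p *+ n.+1)).
  have -> : - (p *+ n.+1) + p = - (p *+ n) by rewrite mulrSr; ring.
  by rewrite IHn mulrSr => /eqP; rewrite -subr_eq => /eqP <-; ring.
have tau_surj t : exists s, tau s = t.
  pose n := Num.bound (`|t - tau 0| / T).
  have : `|t - tau 0| <= T *+ n.
    rewrite -mulr_natl -ler_pdivrMr// ltW//; apply: archi_boundP.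
    by rewrite divr_ge0// ltW.
  rewrite ler_norml => /andP[t1 t2].
  have pn : - (p *+ n) <= p *+ n.
    by have : 0 <= p *+ n by [rewrite mulrn_wge0// ltW]; lra.
  have [||s _ <-] := @IVT R tau _ _ t pn.
  - by apply: continuous_subspaceT => x; exact: isd_cont (taud x).
  - rewrite taun tauNn ge_min le_max; apply/andP; split; apply/orP; [left|right]; lra.
  by exists s.
pose th t := projT1 (cid (tau_surj t)).
have thK t : tau (th t) = t by rewrite /th; case: cid.
have tauK s : th (tau s) = s by apply: tau_inj; rewrite thK.
exists th, T; split => //.
- by move=> t; apply: tau_inj; rewrite thK tauT thK.
- move=> t; rewrite -{1}(thK t); apply: (is_derive_inverse (f := tau)).
  + by near=> s; exact: tauK.
  + by near=> s; exact: isd_cont (taud s).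
  + by rewrite gt_eqF.
- by move=> s; exists (tau s).
Unshelve. all: by end_near. Qed.

Section Oval.
Variable h : R.
Hypothesis h_itv : 0 < h < 3 / 4.

Let l := root4 (3 / 4 - h).

Let l4 : l ^+ 4 = 3 / 4 - h.
Proof. by case/andP: h_itv => h0 h34; rewrite root4K//; lra. Qed.

Let l0 : 0 < l.
Proof. by case/andP: h_itv => h0 h34; apply: root4_gt0; lra. Qed.

Definition ovalY (t : R) : R := starPsi (l * sin t).

Definition ovalW (t : R) : R := Num.sqrt (1 + sin t ^+ 2).

Definition oval (t : R) : R * R :=
  (expR (ovalY t) * (l ^+ 2 * cos t * ovalW t), ovalY t).

(** The derivative of [ovalY] divided by the abscissa of [oval], as y' = x requires. The factor cos
    t cancels, so the quotient stays positive where x = 0. *)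
Definition oval_speed (t : R) : R :=
  2 * starK (ovalY t) ^+ 3 * expR (ovalY t) / (l * ovalW t).

Let SY t : starS (ovalY t) = l * sin t.
Proof.
apply: (starPsiK l0); first by case/andP: h_itv => h0 h34; rewrite l4; lra.
by rewrite normrM (gtr0_norm l0) ler_piMr ?(ltW l0)// ler_norml sin_geN1 sin_le1.
Qed.

Let W0 t : 0 < ovalW t.
Proof. by rewrite sqrtr_gt0; have := sqr_ge0 (sin t); lra. Qed.

Let isdY (t : R) : is_derive t 1 ovalY
  (2 * starK (ovalY t) ^+ 3 * expR (2 * ovalY t) * (l * cos t)).
Proof.
have H := isd_starPsi (ovalY t); rewrite SY in H.
have Hs : is_derive t 1 (fun s => l * sin s) (l * cos t).
  by have Hs := is_derive_sin t; der eassumption; ring.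
exact: isd_comp Hs H.
Qed.

Let isdW (t : R) : is_derive t 1 ovalW (sin t * cos t / ovalW t).
Proof.
have p0 : 0 < 1 + sin t ^+ 2 by have := sqr_ge0 (sin t); lra.
have Hs : is_derive t 1 (fun s => 1 + sin s ^+ 2) (2 * sin t * cos t).
  by have Hs := is_derive_sin t; der eassumption; ring.
apply: isd_eq (isd_comp Hs (is_derive1_sqrt p0)) _.
rewrite -/(ovalW t); field; exact: lt0r_neq0.
Qed.

Lemma oval_speed_gt0 t : 0 < oval_speed t.
Proof.
by rewrite divr_gt0 ?mulr_gt0 ?exprn_gt0 ?starK_gt0 ?expR_gt0.
Qed.

Lemma oval_speed_continuous : continuous oval_speed.
Proof.
move=> t; have Yc := isd_cont (isdY t).
apply: cvgM; last first.
  apply: cvgV; first by rewrite gt_eqF// mulr_gt0.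
  by apply: cvgM; [exact: cvg_cst|exact: isd_cont (isdW t)].
apply: cvgM; last by apply: continuous_comp Yc _; exact: continuous_expR.
apply: cvgM; first exact: cvg_cst.
apply: (@continuous_comp _ _ _ (fun t => starK (ovalY t)) (fun x => x ^+ 3)).
  by apply: continuous_comp Yc _; exact: starK_continuous.
exact: exprn_continuous.
Qed.

Lemma isd_oval (t : R) :
  is_derive t 1 (fun s => (oval s).1) (oval_speed t * (star (oval t)).1) /\
  is_derive t 1 (fun s => (oval s).2) (oval_speed t * (star (oval t)).2).
Proof.
have HY := isdY t; have HW := isdW t; have Hc := is_derive_cos t.
have ln := lt0r_neq0 l0; have Wn := lt0r_neq0 (W0 t).
have Kn := lt0r_neq0 (starK_gt0 (ovalY t)).
have e2 : expR (2 * ovalY t) = expR (ovalY t) ^+ 2 by rewrite expRM_natl.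
have W2 : ovalW t ^+ 2 = 1 + sin t ^+ 2 by rewrite sqr_sqrtr// addr_ge0// sqr_ge0.
have c2 := cos2Dsin2 t.
split; last first.
  apply: isd_eq HY _; rewrite /oval_speed /star /= e2; field.
  by rewrite ln Wn.
rewrite /oval /=; der eassumption.
rewrite /oval_speed /star /= e2.
have Y3 : (starK (ovalY t) * ovalY t) ^+ 3 = l ^+ 3 * sin t ^+ 3.
  by rewrite -exprMn -SY /starS mulrC.
set e := expR _; set s := sin t in W2 c2 Y3 *; set c := cos t in c2 *.
set w := ovalW t in Wn W2 *; set K := starK _ in Kn Y3 *; set y := ovalY t in Y3 *.
have -> : 2 * K ^+ 3 * e / (l * w) * (- y ^+ 3 + (e * (l ^+ 2 * c * w)) ^+ 2)
  = - 2 * e * (K * y) ^+ 3 / (l * w) + 2 * K ^+ 3 * e ^+ 3 * l ^+ 3 * c ^+ 2 * w by field; rewrite ln Wn.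
rewrite Y3.
have -> : - 2 * e * (l ^+ 3 * s ^+ 3) / (l * w) = e * l ^+ 2 * (s * (- 2 * s ^+ 2) / w).
  by field; rewrite ln Wn.
(* From w^2 = 1 + s^2 and c^2 + s^2 = 1. *)
have -> : - 2 * s ^+ 2 = c ^+ 2 - w ^+ 2 by lra.
by field.
Qed.

Lemma oval2pi t : oval (t + pi *+ 2) = oval t.
Proof. by rewrite /oval /ovalY /ovalW sinD2pi cosD2pi. Qed.

Lemma range_oval : range oval = level_curve starH h.
Proof.
have HE t : starH (oval t) = h.
  rewrite starHE /=.
  have -> : profile (ovalY t) = 3 / 4 - (l * sin t) ^+ 4 by rewrite -SY starS4; ring.
  rewrite expRN mulrAC mulfV ?gt_eqF ?expR_gt0// mul1r.
  have -> : (l ^+ 2 * cos t * ovalW t) ^+ 2 = l ^+ 4 * cos t ^+ 2 * ovalW t ^+ 2 by ring.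
  have -> : (l * sin t) ^+ 4 = l ^+ 4 * sin t ^+ 4 by ring.
  by rewrite l4 /ovalW sqr_sqrtr ?addr_ge0 ?sqr_ge0// cos2sin2; ring.
apply/seteqP; split=> [_ [t _ <-]|[x y]]; first exact: HE.
rewrite /level_curve /= starHE /=; set X := x * _ => E.
have xE : x = expR y * X by rewrite /X mulrCA -expRD addrN expR0 mulr1.
clearbody X.
have S4 : starS y ^+ 4 + X ^+ 2 = l ^+ 4 by rewrite l4 starS4; lra.
pose u := starS y / l.
have u4 : u ^+ 4 <= 1.
  rewrite expr_div_n ler_pdivrMr ?exprn_gt0// mul1r -S4.
  by have := sqr_ge0 X; lra.
have u1 : -1 <= u <= 1.
  rewrite -ler_norml -(ler_pXn2r (n := 4))// ?nnegrE// expr1n.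
  by rewrite -normrX ger0_norm// exprn_even_ge0.
have uS : l * u = starS y by rewrite /u mulrC divfK// lt0r_neq0.
clearbody u.
have X2 : (l ^+ 2 * Num.sqrt (1 - u ^+ 2) * Num.sqrt (1 + u ^+ 2)) ^+ 2 = X ^+ 2.
  have u2 : u ^+ 2 <= 1 by rewrite -(@ler_pXn2r _ 2)// ?nnegrE ?sqr_ge0// expr1n -exprM.
  have u20 := sqr_ge0 u.
  have v1 : 0 <= 1 - u ^+ 2 by lra.
  have v2 : 0 <= 1 + u ^+ 2 by lra.
  have -> : X ^+ 2 = l ^+ 4 - (l * u) ^+ 4 by rewrite uS -S4; ring.
  rewrite exprMn exprMn (sqr_sqrtr v1) (sqr_sqrtr v2); ring.
have sa := asinK (x := u); rewrite in_itv /= in sa; have {}sa := sa u1.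
have W t : sin t = u -> ovalW t = Num.sqrt (1 + u ^+ 2) by rewrite /ovalW => ->.
have Y t : sin t = u -> ovalY t = y by rewrite /ovalY => ->; rewrite uS starSK.
(* The sign of X selects one of the two angles with sine u, [asin u] and [pi - asin u]. *)
move/eqP: X2; rewrite eqf_sqr => /orP[] /eqP X2.
  exists (asin u) => //; rewrite /oval W// Y// cos_asin// X2; congr pair.
  by rewrite xE.
have sp : sin (asin u + pi) = - u by rewrite sinDpi sa.
have sp' : sin (pi - asin u) = u.
  by rewrite addrC sinDpi sinN sa opprK.
exists (pi - asin u) => //; rewrite /oval W// Y//; congr pair.
rewrite addrC cosDpi cosN cos_asin//.
by rewrite xE mulrN mulNr X2 opprK.
Qed.

Lemma level_curve_periodic : periodic_orbit star (level_curve starH h).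
Proof.
have pi2 : 0 < pi *+ 2 :> R by rewrite mulrn_wgt0// pi_gt0.
have speedp t : oval_speed (t + pi *+ 2) = oval_speed t.
  by rewrite /oval_speed /ovalY /ovalW sinD2pi.
have [th [T [T0 thT thd ths]]] :=
  periodic_reparametrization pi2 oval_speed_continuous oval_speed_gt0 speedp.
have rg : range (fun t => oval (th t)) = level_curve starH h.
  rewrite -range_oval; apply/seteqP; split=> _ [t _ <-]; first by exists (th t).
  by have [s <-] := ths t; exists s.
exists (fun t => oval (th t)), T; split => //.
- move=> t _; have [H1 H2] := isd_oval (th t).
  have sn := lt0r_neq0 (oval_speed_gt0 (th t)).
  split.
    apply: isd_eq (isd_comp (thd t) H1) _.
    by rewrite mulrAC mulfV// mul1r.
  apply: isd_eq (isd_comp (thd t) H2) _.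
  by rewrite mulrAC mulfV// mul1r.
- by move=> t; rewrite thT oval2pi.
- apply: contrapT => H.
  have cst t : oval (th t) = oval (th 0) by apply: contrapT => tt; apply: H; exists t.
  (* The curve meets the x-axis at l^2 and at - l^2, so its parametrization is not constant. *)
  have onC (x : R) : x ^+ 2 = l ^+ 4 -> (x, 0) = oval (th 0).
    move=> x2; have : level_curve starH h (x, 0).
      by rewrite /level_curve /= starHE /= oppr0 expR0 mulr1 profile0 x2 l4; ring.
    by rewrite -rg => -[t _ <-]; exact: cst.
  have E1 : (l ^+ 2, 0) = oval (th 0) by apply: onC; ring.
  have E2 : (- l ^+ 2, 0) = oval (th 0) by apply: onC; ring.
  have := congr1 fst (etrans E1 (esym E2)) => /= E.
  by have : 0 < l ^+ 2 by [rewrite exprn_gt0]; lra.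
Qed.

End Oval.
End LevelCurves.

(** * The period annulus *)

Section Star.
Context {R : realType}.
Implicit Types (x y : R) (g : R -> R * R) (z : R * R) (O : set (R * R)).

Lemma differentiable_fst (z : R * R) : differentiable (fun z : R * R => z.1) z.
Proof.
apply: (@linear_differentiable R (R * R)%type R (@fst R R)) => w.
exact: continuous_fst.
Qed.

Lemma differentiable_snd (z : R * R) : differentiable (fun z : R * R => z.2) z.
Proof.
apply: (@linear_differentiable R (R * R)%type R (@snd R R)) => w.
exact: continuous_snd.
Qed.

Lemma differentiable_starH (z : R * R) : differentiable (@starH R) z.
Proof.
have d1 := differentiable_fst; have d2 := differentiable_snd.
have dc (c : R) : differentiable (fun _ : R * R => c) z by exact: differentiable_cst.
have dM (f h : R * R -> R) : differentiable f z -> differentiable h z ->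
    differentiable (fun z => f z * h z) z by exact: differentiableM.
have dX (f : R * R -> R) n : differentiable f z -> differentiable (fun z => f z ^+ n) z.
  move=> fd; elim: n => [|n IHn]; first exact: dc.
  by under eq_fun do rewrite exprS; exact: dM.
have dD (f h : R * R -> R) : differentiable f z -> differentiable h z ->
    differentiable (fun z => f z + h z) z by exact: differentiableD.
have dN (f : R * R -> R) : differentiable f z -> differentiable (fun z => - f z) z.
  exact: differentiableN.
have dE (f : R * R -> R) : differentiable f z -> differentiable (fun z => expR (f z)) z.
  move=> fd; apply: (@differentiable_comp _ _ _ _ f expR) => //.
  by apply/derivable1_diffP; exact: derivable_expR.
rewrite /starH; apply: (dM (fun z => z.2 ^+ 3 + 3 / 2 * z.2 ^+ 2 + 3 / 2 * z.2 - z.1 ^+ 2 + 3 / 4)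
  (fun z => expR (- 2 * z.2))).
  apply: (dD (fun z => z.2 ^+ 3 + 3 / 2 * z.2 ^+ 2 + 3 / 2 * z.2 - z.1 ^+ 2)) => //.
  apply: (dD (fun z => z.2 ^+ 3 + 3 / 2 * z.2 ^+ 2 + 3 / 2 * z.2) (fun z => - z.1 ^+ 2)).
    apply: (dD (fun z => z.2 ^+ 3 + 3 / 2 * z.2 ^+ 2) (fun z => 3 / 2 * z.2)).
      apply: (dD (fun z => z.2 ^+ 3) (fun z => 3 / 2 * z.2 ^+ 2)); first exact: dX.
      by apply: (dM (fun=> 3 / 2) (fun z => z.2 ^+ 2)) => //; exact: dX.
    exact: (dM (fun=> 3 / 2) (fun z => z.2)).
  by apply: (dN (fun z => z.1 ^+ 2)); exact: dX.
by apply: dE; apply: (dM (fun=> - 2) (fun z => z.2)).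
Qed.

Lemma starH_continuous : continuous (@starH R).
Proof. by move=> z; apply: differentiable_continuous; exact: differentiable_starH. Qed.

Lemma isd_starH g (t : R) :
  is_derive t 1 (fun s => (g s).1) (star (g t)).1 ->
  is_derive t 1 (fun s => (g s).2) (star (g t)).2 ->
  is_derive t 1 (fun s => starH (g s)) 0.
Proof.
by move=> g1 g2; rewrite /starH; der eassumption; rewrite /star /=; field.
Qed.

Lemma first_integral_starH : first_integral (@star R) starH.
Proof.
split.
- exact: differentiable_starH.
- move=> U oU [[x y] Uxy].
  have /nbhs_ballP[e /= e0 eU] : nbhs (x, y) U by exact: open_nbhs_nbhs.
  have U' d : `|d| < e -> U (x + d, y).
    move=> de; apply: eU; split; rewrite /ball /=; last by rewrite subrr normr0.
    by rewrite opprD addrA subrr sub0r normrN.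
  have HE d d' : starH (x + d, y) = starH (x + d', y) -> (x + d) ^+ 2 = (x + d') ^+ 2.
    rewrite /starH /= => /mulIf; rewrite gt_eqF ?expR_gt0// => /(_ isT) E; lra.
  (* A horizontal move away from the y-axis increases x^2 and changes H. *)
  have [xe|xe] := leP 0 x.
    exists (x + 0, y), (x + e / 2, y); split.
    + by apply: U'; rewrite normr0.
    + by apply: U'; rewrite gtr0_norm ?divr_gt0//; lra.
    + move=> /HE; have : 0 <= x * e by rewrite mulr_ge0// ltW.
      have : 0 < e ^+ 2 by rewrite exprn_gt0.
      by rewrite !sqrrD; lra.
  exists (x + 0, y), (x + - (e / 2), y); split.
  + by apply: U'; rewrite normr0.
  + by apply: U'; rewrite normrN gtr0_norm ?divr_gt0//; lra.
  + move=> /HE; have : 0 < - x * e by rewrite mulr_gt0// oppr_gt0.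
    have : 0 < e ^+ 2 by rewrite exprn_gt0.
    by rewrite !sqrrD; lra.
- move=> a b g gF.
  have lt s t : s \in `]a, b[%R -> t \in `]a, b[%R -> s < t -> starH (g s) = starH (g t).
    rewrite !in_itv /= => /andP[s1 s2] /andP[t1 t2] st.
    have [|c _] := @mvt R (fun s => starH (g s)) (fun=> 0) s t st.
      move=> r rst; have [|g1 g2] := gF r; first by rewrite /= in_itv /=; lra.
      exact: isd_starH.
    by rewrite mul0r; lra.
  move=> s t sab tab; have [st|ts|->//] := ltgtP s t; first exact: lt.
  by apply/esym; exact: lt.
Qed.

Lemma integrating_factor_starH : integrating_factor (@star R) starH starM.
Proof.
by move=> x y; split; rewrite /starH /starM /star /=; der fail; field.
Qed.

Lemma sol_starH g : solution_on setT star g -> forall t, starH (g t) = starH (g 0).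
Proof.
move=> gF; apply: (@isd0_cst R (fun t => starH (g t))) => t.
by have [g1 g2] := gF t I; exact: isd_starH.
Qed.

Lemma profile_anti : {in Num.nneg &, {homo (@profile R) : x y /~ x <= y}}.
Proof.
move=> x y; rewrite !nnegrE => x0 y0; rewrite le_eqVlt => /predU1P[->//|yx].
have [c /andP[c1 c2] E] := mvt yx (fun t _ => isd_profile t).
rewrite -subr_le0 E nmulr_rle0 ?subr_ge0 ?(ltW yx)//.
by rewrite pmulr_llt0 ?expR_gt0// mulNr oppr_lt0 mulr_gt0// exprn_gt0//; lra.
Qed.

Lemma profile_homo x y : x <= y -> y <= 0 -> profile x <= profile y.
Proof.
rewrite le_eqVlt => /predU1P[->//|xy] y0.
have [c /andP[c1 c2] E] := mvt xy (fun t _ => isd_profile t).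
rewrite -subr_ge0 E mulr_ge0 ?subr_ge0 ?(ltW xy)//.
rewrite mulr_ge0 ?expR_ge0// mulNr -mulrN mulr_ge0// oppr_ge0 exprn_odd_le0//; lra.
Qed.

Lemma starH_lt z : z <> (0, 0) -> starH z < 3 / 4.
Proof.
case: z => x y z0; rewrite starHE /=.
have [y0|y0] := eqVneq y 0; last first.
  have := profile_lt y0; have := sqr_ge0 (x * expR (- y)); lra.
have x0 : x != 0 by apply/eqP => x0; apply: z0; rewrite x0 y0.
have : 0 < (x * expR (- y)) ^+ 2.
  by rewrite exprn_even_gt0//= mulf_neq0// gt_eqF// expR_gt0.
by rewrite y0 profile0; lra.
Qed.

Lemma starH0 : starH ((0, 0) : R * R) = 3 / 4.
Proof. by rewrite starHE /= profile0 mul0r expr0n subr0. Qed.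

(** If H <= 0, then x' = x^2 - y^3 >= 3/2 (y^2 + y + 1/2) > 0, which Rolle's theorem forbids. *)
Lemma sol_starH_gt0 g (T : R) : solution_on setT star g -> 0 < T ->
  (forall t, g (t + T) = g t) -> 0 < starH (g 0).
Proof.
move=> gF T0 gT; rewrite ltNge; apply/negP => H0.
have [t|t|t] := @periodic_speed0 R (fun t => (g t).1) (fun t => (star (g t)).1) T T0.
- by rewrite gT.
- by have [] := gF t I.
have := sol_starH gF t; rewrite /star /starH; case: (g t) => x y /= E.
have {}E : y ^+ 3 + 3 / 2 * y ^+ 2 + 3 / 2 * y - x ^+ 2 + 3 / 4 <= 0.
  by rewrite -(pmulr_lle0 _ (expR_gt0 (- 2 * y))) E.
by have := sqr_ge0 (y + 1 / 2); rewrite sqrrD; lra.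
Qed.

Lemma open_starH_gt h : open [set z : R * R | h < starH z].
Proof.
rewrite (_ : [set _ | _] = starH @^-1` [set r | h < r])//.
by apply: open_comp (@open_gt R h) => z _; exact: starH_continuous.
Qed.

(** Each point is joined to the origin inside the set, horizontally to the y-axis and then along it:
    H does not decrease on the way. *)
Lemma connected_starH_gt0 : connected [set z : R * R | 0 < starH z].
Proof.
pose C (z : R * R) : set (R * R) := (fun t => (t * z.1, z.2)) @` `[0, 1] `|`
  (fun t => (0, t * z.2)) @` `[0, 1].
have CC (z : R * R) : connected (C z).
  have cc (a b c d : R) : connected ((fun t : R => (t * a + b, t * c + d)) @` `[0, 1]).
    apply: connected_continuous_connected; first exact: segment_connected.
    apply: continuous_subspaceT => t.
    have cont (p q : R) : {for t, continuous (fun t : R => t * p + q)} by apply: isd_cont; der fail.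
    exact: (@cvg_pair _ _ _ (nbhs t) (nbhs _) (nbhs _) _ _ _ _ _ (cont a b) (cont c d)).
  apply: connectedU.
  - exists (0, z.2); split; [exists 0|exists 1]; rewrite /= ?in_itv /= ?lexx ?ler01//.
      by rewrite mul0r.
    by rewrite mul1r.
  - rewrite (_ : (fun t => _) = (fun t : R => (t * z.1 + 0, t * 0 + z.2))); first exact: cc.
    by apply/funext => t; rewrite addr0 mulr0 add0r.
  - rewrite (_ : (fun t => _) = (fun t : R => (t * 0 + 0, t * z.2 + 0))); first exact: cc.
    by apply/funext => t; rewrite mulr0 !addr0.
have CE (z w : R * R) : 0 < starH z -> C z w -> 0 < starH w.
  case: z => x y; rewrite !starHE /= => H [] [t]; rewrite /= in_itv /= => /andP[t0 t1] <- /=.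
    apply: lt_le_trans H _; rewrite lerD2l lerN2 -mulrA exprMn ler_piMl ?sqr_ge0//.
    by rewrite expr_le1.
  rewrite mul0r expr0n subr0; have := sqr_ge0 (x * expR (- y)) => X0.
  apply: (@lt_le_trans _ _ (profile y)); first by lra.
  have [y0|y0] := leP 0 y.
    by apply: profile_anti; rewrite ?nnegrE ?mulr_ge0// ler_piMl.
  by apply: profile_homo; [rewrite ler_niMl// ltW|rewrite mulr_ge0_le0// ltW].
have -> : [set z : R * R | 0 < starH z] = \bigcup_(z in [set z | 0 < starH z]) C z.
  apply/seteqP; split=> [z Hz|w [z Hz]]; last exact: CE.
  by exists z => //; left; exists 1; rewrite /= ?in_itv /= ?lexx ?ler01// mul1r; case: z Hz.
apply: bigcup_connected; last by move=> z _.
exists (0, 0) => z _; right; exists 0; rewrite /= ?in_itv /= ?lexx ?ler01//.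
by rewrite mul0r.
Qed.

Lemma starH_annulusE : [set z : R * R | 0 < starH z < 3 / 4]
  = [set z | 0 < starH z] `\ (0, 0).
Proof.
apply/seteqP; split=> z /=.
  move=> /andP[-> H]; split => // z0; move: H; rewrite z0 starH0 ltxx //.
by move=> [-> /starH_lt ->].
Qed.

Lemma punctured_starH : punctured_nbhd (0, 0) [set z : R * R | 0 < starH z < 3 / 4].
Proof.
exists [set z | 0 < starH z]; split.
- exact: open_starH_gt.
- exact: connected_starH_gt0.
- by rewrite /= starH0; lra.
- exact: starH_annulusE.
Qed.

(** The profile confines y to [-1, b]; then |x e^(-y)| <= 1 because the profile is at most 3/4, and
    |x| <= e^b. *)
Lemma bounded_starH_gt h : 0 < h -> exists M, forall z : R * R, h < starH z ->
  `|z.1| <= M /\ `|z.2| <= M.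
Proof.
move=> h0; have [b b0 bh] := profile_small h0.
have p1 : profile (-1 : R) < 0.
  have e0 : 0 < expR (- 2 * -1) :> R := expR_gt0 _.
  by rewrite /profile; lra.
exists (1 + b + expR b) => -[x y]; rewrite starHE /= => H.
have X0 := sqr_ge0 (x * expR (- y)); have eb := expR_gt0 b.
have y1 : -1 <= y.
  rewrite leNgt; apply/negP => y1.
  have : profile y <= profile (-1) by apply: profile_homo; [exact: ltW|rewrite lerN10].
  by lra.
have yb : y <= b.
  rewrite leNgt; apply/negP => yb.
  have : profile y <= profile b by apply: profile_anti; rewrite ?nnegrE ?ltW//; lra.
  by lra.
split; last by rewrite ler_norml; lra.
have [->|y0] := eqVneq x 0; first by rewrite normr0; lra.
have p34 : profile y <= 3 / 4.
  by have [->|y0'] := eqVneq y 0; [rewrite profile0|exact: ltW (profile_lt y0')].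
have X1 : `|x * expR (- y)| <= 1.
  by rewrite -(ler_pXn2r (n := 2))// ?nnegrE// real_normK ?num_real// expr1n; lra.
have -> : x = x * expR (- y) * expR y by rewrite -mulrA -expRD addNr expR0 mulr1.
rewrite normrM (gtr0_norm (expR_gt0 y)).
have : `|x * expR (- y)| * expR y <= 1 * expR b.
  by apply: ler_pM; rewrite ?expR_ge0 ?ler_expR.
by lra.
Qed.

(** On a connected set that contains the origin, where H = 3/4, and misses the level h, H stays
    above h; such points are bounded. *)
Lemma surrounds_level h : 0 < h < 3 / 4 -> surrounds (level_curve (@starH R) h) (0, 0).
Proof.
move=> /andP[h0 h34]; split.
  by rewrite /level_curve /= starH0; lra.
have [M MP] := bounded_starH_gt h0.
have sub : connected_component (~` level_curve starH h) (0, 0) `<=` [set z : R * R | h < starH z].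
  move=> z [B [B0 Bh Bc] Bz] /=.
  rewrite ltNge; apply/negP => Hz.
  have /connected_intervalP Ic : connected (starH @` B).
    apply: connected_continuous_connected => //.
    by apply: continuous_subspaceT; exact: starH_continuous.
  have [w Bw wh] : (starH @` B) h.
    have Iz : (starH @` B) (starH z) by exists z.
    have I0 : (starH @` B) (3 / 4) by exists (0, 0) => //; exact: starH0.
    by apply: (Ic _ _ Iz I0); rewrite Hz ltW.
  by have := Bh _ Bw; apply.
rewrite /bounded_set; exists M; split; first exact: num_real.
move=> N MN z /sub /= /MP[z1 z2].
by rewrite prod_normE ge_max; apply/andP; split; apply: le_trans (ltW MN).
Qed.

Lemma periodic_orbit_sub (w : R * R) : 0 < starH w < 3 / 4 ->
  [/\ periodic_orbit star (level_curve starH (starH w)), level_curve starH (starH w) w &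
    level_curve starH (starH w) `<=` [set z | 0 < starH z < 3 / 4]].
Proof.
move=> hw; split => //; first exact: level_curve_periodic.
by move=> z; rewrite /level_curve /= => ->.
Qed.

Lemma center_star : is_center (@star R) (0, 0).
Proof.
split; first by rewrite /singular_point /star /= !expr0n oppr0 addr0.
exists [set z | 0 < starH z < 3 / 4]; first exact: punctured_starH.
by move=> w /periodic_orbit_sub; exists (level_curve starH (starH w)).
Qed.

(** Maximality: H is positive on every periodic orbit and less than 3/4 off the origin. *)
Lemma period_annulus_star :
  period_annulus (@star R) (0, 0) [set z | 0 < starH z < 3 / 4].
Proof.
split.
  split; first exact: punctured_starH.
  move=> w Aw; exists (level_curve starH (starH w)).
  by have [? ? ?] := periodic_orbit_sub Aw; split => //; exact: surrounds_level.
move=> B [[U [_ _ _ BE]] BP] w Bw /=.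
have w0 : w <> (0, 0) by move: Bw; rewrite BE => -[].
rewrite starH_lt// andbT.
have [Orb [[g [T [gF T0 gT _ OE]]] Ow _ _]] := BP w Bw.
move: Ow; rewrite OE => -[t _ <-].
by rewrite (sol_starH gF); exact: sol_starH_gt0 gF T0 gT.
Qed.

(** An orbit in the annulus stays on a level; by uniqueness it is a time shift of the explicit
    solution, hence fills that level. *)
Lemma periodic_orbit_star Orb :
  (periodic_orbit star Orb /\ Orb `<=` [set z | 0 < starH z < 3 / 4]) <->
  (exists2 h : R, 0 < h < 3 / 4 & Orb = level_curve starH h).
Proof.
split=> [[[g [T [gF T0 gT _ OE]]] OA]|[h hh ->]]; last first.
  by split; [exact: level_curve_periodic|move=> z; rewrite /level_curve /= => ->].
have hg : 0 < starH (g 0) < 3 / 4 by apply: (OA (g 0)); rewrite OE; exists 0.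
exists (starH (g 0)) => //.
have [[k [_ [kF _ _ _ LE]]] Lg _] := periodic_orbit_sub hg.
move: Lg; rewrite LE => -[s _ ks].
have lip1 : loc_lip (fun z : R * R => (star z).1).
  apply: loc_lipD; last by apply: loc_lipX; exact: loc_lip_fst.
  under eq_fun do rewrite -mulN1r.
  by apply: loc_lipM; [exact: loc_lip_cst|apply: loc_lipX; exact: loc_lip_snd].
have gk := sol_uniq lip1 loc_lip_fst gF (sol_shift s kF).
have {}gk t : g t = k (t + s) by apply: gk; rewrite add0r.
rewrite OE; apply/seteqP; split=> _ [t _ <-]; first by exists (t + s).
by exists (t - s) => //; rewrite gk subrK.
Qed.

End Star.

Theorem theorem1 (R : realType) :
  (forall (P Q : bipoly R) (n : nat),
     P != 0 -> Q != 0 ->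
     semi_quasi_homogeneous P Q -> ~ semihomogeneous P Q ->
     n = maxn (total_degree P) (total_degree Q) ->
     (n = 2%N -> ~ exists z, is_center (polysys P Q) z) /\
     (n = 3%N -> ((exists z, is_center (polysys P Q) z) <->
                  can_be_written_as (polysys P Q) star)))
  /\
  [/\ first_integral (@star R) starH,
      integrating_factor (@star R) starH starM,
      is_center (@star R) (0, 0),
      period_annulus (@star R) (0, 0) [set z | 0 < starH z < 3 / 4] &
      forall O : set (R * R),
        (periodic_orbit star O /\ O `<=` [set z | 0 < starH z < 3 / 4]) <->
        (exists2 h : R, 0 < h < 3 / 4 & O = level_curve starH h)].
Proof.
split; last first.
  split.
  - exact: first_integral_starH.
  - exact: integrating_factor_starH.
  - exact: center_star.
  - exact: period_annulus_star.
  - exact: periodic_orbit_star.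
move=> P Q n _ _ sqh nh nE.
(* The sizes exceed the degrees by one, hence 4. *)
have small : (n <= 3)%N -> (msize P <= 4)%N /\ (msize Q <= 4)%N.
  by move: nE; rewrite /total_degree; lia.
split=> n_eq.
  move=> [z zc]; have [|P4 Q4] := small; first by rewrite n_eq.
  have [_] := center_star_form P4 Q4 sqh nh zc.
  by move: nE; rewrite n_eq /total_degree; lia.
have [|P4 Q4] := small; first by rewrite n_eq.
split=> [[z zc]|H]; first by have [] := center_star_form P4 Q4 sqh nh zc.
by exists (0, 0); apply: (center_can_be_written_as H); exact: center_star.
Qed.
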